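(* Let $G$ be a Halin graph. If $G$ is not isomorphic to $K_4$, then $\mathrm{box}(G)=2$; if $G$ is isomorphic to $K_4$, then $\mathrm{box}(G)=1$.
   Context: Graphs are finite, simple and undirected. A leaf of a tree is a vertex of degree $1$ in the tree. A simple cycle has at least $3$ vertices. A graph $G$ is a Halin graph if it is planar and $G=T\cup C$, meaning $E(G)=E(T)\cup E(C)$, where $T$ is a tree with $V(T)=V(G)$ having no vertex of degree $2$ (in $T$), and $C$ is a simple cycle whose vertex set is exactly the set of leaves of $T$. A $k$-dimensional box ($k$-box) is a Cartesian product $R_1\times R_2\times\cdots\times R_k$ where each $R_i$ is a (nonempty, possibly degenerate) closed interval $[a,b]$, $a\le b$, on the real line. A graph $G$ is the intersection graph of a collection of $k$-boxes $\{B_v\}_{v\in V(G)}$ if for all distinct $u,v\in V(G)$: $uv\in E(G)$ if and only if $B_u\cap B_v\neq\emptyset$. The boxicity $\mathrm{box}(G)$ is the minimum integer $k\ge 1$ such that $G$ is the intersection graph of a collection of $k$-boxes (the boxicity of a complete graph is taken to be $1$). *)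

(* Defs.v *)
From HB Require Import structures.
From mathcomp Require Import all_boot all_order all_algebra.
From mathcomp Require Import all_classical all_reals all_analysis.
Set Implicit Arguments.
Unset Strict Implicit.
Unset Printing Implicit Defensive.
Import Order.TTheory GRing.Theory Num.Theory.
Import numFieldNormedType.Exports.
Local Open Scope classical_set_scope.
Local Open Scope ring_scope.

(* A graph on the finite vertex set V is given by its adjacency relation.    *)
Definition simple_graph (V : finType) (e : rel V) : Prop :=
  symmetric e /\ irreflexive e.

Definition degree (V : finType) (e : rel V) (x : V) : nat := #|[pred y | e x y]|.

Definition isomorphic (V W : finType) (e : rel V) (e' : rel W) : Prop :=
  exists2 f : V -> W, bijective f & forall x y, e' (f x) (f y) = e x y.

Definition complete_graph (n : nat) : rel 'I_n := fun i j => i != j.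

(* Every vertex of V belongs to the tree.  A simple cycle of the graph is a  *)
(* duplicate-free cyclic path with at least 3 vertices.                      *)
Definition tree (V : finType) (t : rel V) : Prop :=
  [/\ simple_graph t, (0 < #|V|)%N, forall x y, connect t x y
    & forall s : seq V, ucycle t s -> (size s < 3)%N].

(* Adjacency in the cycle that visits the vertices of c in cyclic order;     *)
(* this is a simple cycle when c is duplicate-free and has size at least 3.  *)
Definition cycle_graph (V : finType) (c : seq V) : rel V :=
  fun x y => [&& x \in c, y \in c & (y == next c x) || (x == next c y)].

(* A simple arc of the plane: a homeomorphic image of [0, 1], the unit       *)
(* interval being compact and the plane Hausdorff.                           *)
Definition arc_between (R : realType) (A : set (R * R)) (p q : R * R) : Prop :=
  exists g : R -> R * R,
    [/\ {within `[0, 1], continuous g}, {in `[0, 1] &, injective g},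
        g 0 = p, g 1 = q & A = g @` `[0, 1]].

(* The last condition says that two edges meet only at vertices; these are   *)
(* common ends of the two edges, by the condition before it.                 *)
Definition plane_drawing (R : realType) (V : finType) (e : rel V)
    (pos : V -> R * R) (edge : V -> V -> set (R * R)) : Prop :=
  [/\ injective pos,
      forall u v, edge u v = edge v u,
      forall u v, e u v -> arc_between (edge u v) (pos u) (pos v),
      forall u v w, e u v -> edge u v (pos w) -> w = u \/ w = v
    & forall u v x y, e u v -> e x y -> [set u; v] <> [set x; y] ->
        edge u v `&` edge x y `<=` range pos].

Definition planar (R : realType) (V : finType) (e : rel V) : Prop :=
  exists pos edge, @plane_drawing R V e pos edge.

Definition halin (R : realType) (V : finType) (e : rel V) : Prop :=
  [/\ simple_graph e, planar R e
    & exists (t : rel V) (c : seq V),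
      [/\ tree t, forall x, degree t x <> 2%N,
          uniq c /\ (3 <= size c)%N,
          forall x, (x \in c) = (degree t x == 1%N)
        & forall x y, e x y = t x y || cycle_graph c x y]].

Definition is_box (R : realType) (k : nat) (B : set 'rV[R]_k) : Prop :=
  exists a b : 'I_k -> R, (forall i, a i <= b i) /\
    B = [set p | forall i, p ord0 i \in `[a i, b i]].

Definition box_representable (R : realType) (V : finType) (e : rel V)
    (k : nat) : Prop :=
  exists B : V -> set 'rV[R]_k, (forall v, is_box (B v)) /\
    forall u v, u != v -> (e u v <-> B u `&` B v !=set0).

Definition is_boxicity (R : realType) (V : finType) (e : rel V) (k : nat) :
    Prop :=
  [/\ (1 <= k)%N, box_representable R e k
    & forall j : nat, (1 <= j)%N -> box_representable R e j -> (k <= j)%N].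

(* The minimum is unique when it exists; the default value 0 is never a      *)
(* boxicity.                                                                 *)
Definition boxicity (R : realType) (V : finType) (e : rel V) : nat :=
  xget 0%N [set k | is_boxicity R e k].

(* Main.v *)
(* Rooting the tree at a leaf r turns the cycle into a linear order of the
   other leaves.  A plane drawing forces the leaves below any vertex to be
   consecutive in this order: otherwise two disjoint tree paths, a tree path
   joining them and the cycle form a subdivision of K_{3,3}.  Given this, a
   vertex becomes the box (interval of the leaves below it) x (interval around
   its depth); a leaf is stretched down to a common floor, where it touches its
   two neighbours, and the two leaves next to r are stretched up to the box
   of r.

   That K_{3,3} has no drawing is proved without the Jordan curve theorem, by
   van Kampen's parity argument.  For two disjoint paths P and Q, the
   differences P s - Q t never vanish, so the boundary of the parameter square
   has winding number 0 around the origin.  Adding these relations mod 2 over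
   the 18 pairs of independent edges of K_{3,3} gives 1 = 0.  Winding numbers
   are only needed for fine discrete chains of points, which uniform continuity
   extracts from arcs. *)
Require Import Defs.
From mathcomp Require Import all_boot all_order all_algebra.
From mathcomp Require Import all_classical all_reals all_analysis.
From mathcomp Require Import ring lra zify.
Set Implicit Arguments.
Unset Strict Implicit.
Unset Printing Implicit Defensive.
Import Order.TTheory GRing.Theory Num.Theory.
Import numFieldNormedType.Exports.
Local Open Scope classical_set_scope.
Local Open Scope ring_scope.

(** * Parity of crossings *)

(* For nonzero w exactly one of w and - w is upper. *)
Definition upper (R : realType) (w : R * R) : bool :=
  (0 < w.2) || (w.2 == 0) && (0 < w.1).

Definition cross (R : realType) (w z : R * R) : R := w.1 * z.2 - w.2 * z.1.

Definition dot (R : realType) (w z : R * R) : R := w.1 * z.1 + w.2 * z.2.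

(* The segment from w to z crosses the negative half of the first axis. *)
Definition crossing (R : realType) (w z : R * R) : bool :=
  (upper w != upper z) && (if upper w then 0 < cross w z else 0 < cross z w).

(** Here [n] serves as a witness that [w] is nonzero. *)
Lemma upperN (R : realType) (n w : R * R) :
  0 < dot n w -> upper (- w) = ~~ upper w.
Proof.
rewrite /dot /upper /= !oppr_gt0 oppr_eq0.
case: (ltgtP 0 w.2) => [||w20] /=; case: (ltgtP 0 w.1) => [||w10] //=.
by rewrite -w20 -w10 !mulr0 addr0 ltxx.
Qed.

(** Since [z.2 <= 0 <= w.2], both terms of the identity in the proof are nonpositive. They cannot
    both vanish: on the first axis, [w] and [z] would not point the same way, and no half plane
    would contain both. *)
Lemma cross_half_plane (R : realType) (n w z : R * R) :
  0 < dot n w -> 0 < dot n z -> upper w -> ~~ upper z ->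
  n.1 * cross w z < 0.
Proof.
move=> nw nz uw uz.
have -> : n.1 * cross w z = dot n w * z.2 - dot n z * w.2.
  by rewrite /cross /dot; ring.
case/orP: uw => [w2|/andP[/eqP w2 w1]].
  have z2 : z.2 <= 0 by move: uz; rewrite /upper negb_or -leNgt => /andP[].
  nra.
move: uz; rewrite /upper negb_or -leNgt => /andP[z2 uz].
case: (ltgtP z.2 0) z2 => // [z2 _|z2 _]; first by rewrite w2; nra.
move: uz nw nz; rewrite /dot z2 eqxx w2 /= -leNgt => ? ? ?; nra.
Qed.

(** The segment stays in the open half plane with inner normal [n], which contains the negative half
    of the first axis exactly when [n.1 < 0]. *)
Lemma crossing_half_plane (R : realType) (n w z : R * R) :
  0 < dot n w -> 0 < dot n z ->
  crossing w z = (upper w != upper z) && (n.1 < 0).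
Proof.
move=> nw nz; rewrite /crossing; have := cross_half_plane nw nz.
have := cross_half_plane nz nw.
case: (upper w); case: (upper z) => //= H1 H2.
- have {H2} := H2 isT isT; case: (ltgtP n.1 0) => n1; last by rewrite n1 mul0r ltxx.
    by rewrite nmulr_rlt0 // => ->.
  by rewrite pmulr_rlt0 // => /ltW; rewrite leNgt => /negbTE.
- have {H1} := H1 isT isT; case: (ltgtP n.1 0) => n1; last by rewrite n1 mul0r ltxx.
    by rewrite nmulr_rlt0 // => ->.
  by rewrite pmulr_rlt0 // => /ltW; rewrite leNgt => /negbTE.
Qed.

(** Central reflection swaps the two halves of the first axis, and a segment that changes sides
    crosses exactly one of them. *)
Lemma crossingN (R : realType) (n w z : R * R) :
  0 < dot n w -> 0 < dot n z ->
  crossing (- w) (- z) = crossing w z (+) (upper w (+) upper z).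
Proof.
move=> nw nz.
have dotNN (u : R * R) : dot (- n) (- u) = dot n u by rewrite /dot /=; ring.
rewrite (crossing_half_plane nw nz) (@crossing_half_plane _ (- n)) ?dotNN //.
rewrite (upperN nw) (upperN nz).
have := cross_half_plane nw nz; have := cross_half_plane nz nw => /=.
rewrite oppr_lt0.
by case: (upper w); case: (upper z) => //= H1 H2;
  case: (ltgtP n.1 0) => // n1; move: H1 H2; rewrite n1 !mul0r ltxx => H1 H2;
  first [by have := H1 isT isT | by have := H2 isT isT].
Qed.

(** Within a half plane a crossing is a change of [upper] masked by a constant, and a closed circuit
    has an even number of changes. *)
Lemma crossing_square (R : realType) (n w1 w2 w3 w4 : R * R) :
  0 < dot n w1 -> 0 < dot n w2 -> 0 < dot n w3 -> 0 < dot n w4 ->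
  crossing w1 w2 (+) crossing w2 w3 (+) crossing w4 w3 (+) crossing w1 w4
  = false.
Proof.
move=> n1 n2 n3 n4; rewrite !(@crossing_half_plane _ n) //.
by case: (upper w1); case: (upper w2); case: (upper w3); case: (upper w4);
  case: (_ < _).
Qed.

(** The norm is the maximum norm; if M is that of [n], then [dot n (w - n)] is at least - 4 eps M >
    - M^2, while [dot n n] is at least M^2. The allowance [2 * eps] is one step of each of two
    chains. *)
Lemma dot_near_gt0 (R : realType) (eps : R) (n w : R * R) :
  4 * eps < `|n| -> `|w - n| <= 2 * eps -> 0 < dot n w.
Proof.
rewrite !prod_normE /= => far near.
move: near; rewrite ge_max !ler_norml => /andP[/andP[a1 a2] /andP[b1 b2]].
have e0 : 0 <= eps by lra.
have [u v] : n.1 * (w.1 - n.1) >= - (`|n.1| * (2 * eps)) /\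
   n.2 * (w.2 - n.2) >= - (`|n.2| * (2 * eps)).
  split.
  - apply: le_trans (_ : - (`|n.1| * `|w.1 - n.1|) <= _).
      by rewrite lerN2 ler_wpM2l // ler_norml a1.
    by rewrite -normrM lerNl -normrN ler_norm.
  - apply: le_trans (_ : - (`|n.2| * `|w.2 - n.2|) <= _).
      by rewrite lerN2 ler_wpM2l // ler_norml b1.
    by rewrite -normrM lerNl -normrN ler_norm.
have -> : dot n w = `|n.1| ^+ 2 + `|n.2| ^+ 2 + n.1 * (w.1 - n.1)
  + n.2 * (w.2 - n.2).
  by rewrite !real_normK ?num_real // /dot; ring.
have := normr_ge0 n.1; have := normr_ge0 n.2.
move: far u v; rewrite lt_max; move: (n.1 * _) (n.2 * _) `|n.1| `|n.2|.
move=> x y a b far u v b0 a0.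
have AM : 0 <= (a - b) ^+ 2 by rewrite sqr_ge0.
case/orP: far => far.
- have A : 0 <= a * (a - 4 * eps) by rewrite mulr_ge0 //; lra.
  have B : 0 <= b * (a - 4 * eps) by rewrite mulr_ge0 //; lra.
  have : 0 < a * a by rewrite mulr_gt0 //; lra.
  nra.
- have A : 0 <= a * (b - 4 * eps) by rewrite mulr_ge0 //; lra.
  have B : 0 <= b * (b - 4 * eps) by rewrite mulr_ge0 //; lra.
  have : 0 < b * b by rewrite mulr_gt0 //; lra.
  nra.
Qed.

(* The parity of the number of times the chain P, seen from q, crosses the
   direction (-1, 0). *)
Definition view (R : realType) (q : R * R) (P : nat -> R * R) (n : nat) : bool :=
  \big[addb/false]_(i < n) crossing (P i - q) (P i.+1 - q).

(** Stokes' theorem mod 2 on a grid: [f] and [g] live on its horizontal and vertical edges, and in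
    the sum over all cells every inner edge cancels. *)
Lemma sum_addb_telescope (f g : nat -> nat -> bool) (n m : nat) :
  (forall i j, (i < n)%N -> (j < m)%N ->
     f i j (+) g i.+1 j (+) f i j.+1 (+) g i j = false) ->
  \big[addb/false]_(i < n) f i 0%N (+) \big[addb/false]_(i < n) f i m
  (+) \big[addb/false]_(j < m) g 0%N j (+) \big[addb/false]_(j < m) g n j
  = false.
Proof.
elim: n => [|n IHn] H; first by rewrite !big_ord0 /= addbb.
have {}IHn := IHn (fun i j ni => H i j (ltnW ni)).
have {H} : f n 0%N (+) f n m (+) \big[addb/false]_(j < m) g n j
    (+) \big[addb/false]_(j < m) g n.+1 j = false.
  elim: m {IHn} H => [|m IHm] H; first by rewrite !big_ord0 addbb.
  have {}IHm := IHm (fun i j ni mj => H i j ni (ltnW mj)).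
  move: IHm (H n m (ltnSn n) (ltnSn m)); rewrite !big_ord_recr /=.
  by do !case: (\big[addb/false]_(_ < _) _);
    case: (f n 0%N); case: (f n m); case: (f n m.+1); case: (g n m); case: (g n.+1 m).
move: IHn; rewrite !big_ord_recr /=.
by do !case: (\big[addb/false]_(_ < _) _); case: (f n 0%N); case: (f n m).
Qed.

Lemma sum_addb_change (b : nat -> bool) (m : nat) :
  \big[addb/false]_(j < m) (b j (+) b j.+1) = b 0%N (+) b m.
Proof.
elim: m => [|m IHm]; first by rewrite big_ord0 addbb.
by rewrite big_ord_recr /= IHm addbA -[X in X (+) b m.+1]addbA addbb addbF.
Qed.

(** The differences [P i - Q j] at the corners of a grid cell lie in one half plane, so the boundary
    of the whole grid has an even number of crossings. On the two sides where [j] varies they have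
    the sign opposite to that in [view]; correcting it costs the terms in [upper]. *)
Lemma view_grid (R : realType) (eps : R) (P Q : nat -> R * R) (n m : nat) :
  0 <= eps ->
  (forall i, (i < n)%N -> `|P i.+1 - P i| <= eps) ->
  (forall j, (j < m)%N -> `|Q j.+1 - Q j| <= eps) ->
  (forall i j, (i <= n)%N -> (j <= m)%N -> 4 * eps < `|P i - Q j|) ->
  view (Q 0%N) P n (+) view (Q m) P n (+) view (P 0%N) Q m (+) view (P n) Q m
  = upper (Q 0%N - P 0%N) (+) upper (Q m - P 0%N)
    (+) upper (Q 0%N - P n) (+) upper (Q m - P n).
Proof.
move=> e0 sP sQ far.
have dot00 i j : (i <= n)%N -> (j <= m)%N -> 0 < dot (P i - Q j) (P i - Q j).
  move=> ilen jlem; apply: (dot_near_gt0 (far _ _ ilen jlem)).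
  by rewrite subrr normr0 mulr_ge0.
have dot10 i j : (i < n)%N -> (j <= m)%N -> 0 < dot (P i - Q j) (P i.+1 - Q j).
  move=> ilen jlem; apply: (dot_near_gt0 (far _ _ (ltnW ilen) jlem)).
  have -> : P i.+1 - Q j - (P i - Q j) = P i.+1 - P i by ring.
  by have := sP _ ilen; lra.
have dot01 i j : (i <= n)%N -> (j < m)%N -> 0 < dot (P i - Q j) (P i - Q j.+1).
  move=> ilen jlem; apply: (dot_near_gt0 (far _ _ ilen (ltnW jlem))).
  have -> : P i - Q j.+1 - (P i - Q j) = - (Q j.+1 - Q j) by ring.
  by rewrite normrN; have := sQ _ jlem; lra.
have dot11 i j : (i < n)%N -> (j < m)%N ->
    0 < dot (P i - Q j) (P i.+1 - Q j.+1).
  move=> ilen jlem; apply: (dot_near_gt0 (far _ _ (ltnW ilen) (ltnW jlem))).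
  have -> : P i.+1 - Q j.+1 - (P i - Q j) = (P i.+1 - P i) - (Q j.+1 - Q j).
    by ring.
  apply: le_trans (ler_normB _ _) _.
  by have := sQ _ jlem; have := sP _ ilen; lra.
have viewQ i : (i <= n)%N -> view (P i) Q m =
    \big[addb/false]_(j < m) crossing (P i - Q j) (P i - Q j.+1)
    (+) upper (Q 0%N - P i) (+) upper (Q m - P i).
  move=> ilen; rewrite -addbA -(sum_addb_change (fun j => upper (Q j - P i))).
  rewrite -big_split; apply: eq_bigr => j _ /=.
  rewrite -(opprB (Q j)) -(opprB (Q j.+1)).
  have dotN (u v : R * R) : dot (- u) (- v) = dot u v by rewrite /dot /=; ring.
  rewrite (@crossingN _ (- (P i - Q j))).
  - by rewrite -addbA addbb addbF.
  - by rewrite -[Q j - _]opprB dotN dot00 // ltnW.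
  - by rewrite -[Q j.+1 - _]opprB dotN dot01.
have square i j : (i < n)%N -> (j < m)%N ->
    crossing (P i - Q j) (P i.+1 - Q j)
    (+) crossing (P i.+1 - Q j) (P i.+1 - Q j.+1)
    (+) crossing (P i - Q j.+1) (P i.+1 - Q j.+1)
    (+) crossing (P i - Q j) (P i - Q j.+1) = false.
  move=> ni jm.
  by rewrite (@crossing_square _ (P i - Q j)) ?dot00 ?dot10 ?dot01 ?dot11 // ltnW.
move: (sum_addb_telescope square); rewrite !viewQ // /view.
by do 4!case: (\big[addb/false]_(_ < _) _); do 4!case: (upper _).
Qed.

(* Van Kampen's obstruction: [u i j k] and [w i j l] stand for the parities of
   the turns of the path from A i to B j seen from A k and from B l, the other
   terms for the directions of the segments between the branch points.  Each of
   the former occurs in an even number of equations, and the sum of the latter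
   over the 18 pairs of independent paths is odd. *)
Lemma van_kampen_K33 (u w : nat -> nat -> nat -> bool)
    (aa bb ab : nat -> nat -> bool) :
  (forall i j, (i < 3)%N -> (j < 3)%N -> i != j -> bb j i = ~~ bb i j) ->
  (forall i j k l, (i < k < 3)%N -> (j < 3)%N -> (l < 3)%N -> j != l ->
     u i j k (+) w i j l (+) u k l i (+) w k l j
     = aa i k (+) ab i l (+) ~~ ab k j (+) bb j l) ->
  False.
Proof.
move=> anti H.
(* Each relation mod 2 becomes an even sum of naturals, so that linear arithmetic can add all 18 of
   them. *)
have E (i j k l : nat) : (i < k < 3)%N -> (j < 3)%N -> (l < 3)%N -> j != l ->
  exists m : nat, (u i j k + w i j l + u k l i + w k l j
     + aa i k + ab i l + ~~ ab k j + bb j l = 2 * m)%N.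
  move=> ik j3 l3 jl; have := H _ _ _ _ ik j3 l3 jl.
  move=> Hx; exists ((u i j k + w i j l + u k l i + w k l j
     + aa i k + ab i l + ~~ ab k j + bb j l)./2)%N.
  by move: Hx; case: (u i j k); case: (w i j l); case: (u k l i);
    case: (w k l j); case: (aa i k); case: (ab i l); case: (ab k j);
    case: (bb j l).
have F (b : bool) : (~~ b + b = 1)%N by case: b.
have [m0 e0] := E 0%N 0%N 1%N 1%N isT isT isT isT.
have [m1 e1] := E 0%N 0%N 1%N 2%N isT isT isT isT.
have [m2 e2] := E 0%N 1%N 1%N 0%N isT isT isT isT.
have [m3 e3] := E 0%N 1%N 1%N 2%N isT isT isT isT.
have [m4 e4] := E 0%N 2%N 1%N 0%N isT isT isT isT.
have [m5 e5] := E 0%N 2%N 1%N 1%N isT isT isT isT.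
have [n0 f0] := E 0%N 0%N 2%N 1%N isT isT isT isT.
have [n1 f1] := E 0%N 0%N 2%N 2%N isT isT isT isT.
have [n2 f2] := E 0%N 1%N 2%N 0%N isT isT isT isT.
have [n3 f3] := E 0%N 1%N 2%N 2%N isT isT isT isT.
have [n4 f4] := E 0%N 2%N 2%N 0%N isT isT isT isT.
have [n5 f5] := E 0%N 2%N 2%N 1%N isT isT isT isT.
have [p0 g0] := E 1%N 0%N 2%N 1%N isT isT isT isT.
have [p1 g1] := E 1%N 0%N 2%N 2%N isT isT isT isT.
have [p2 g2] := E 1%N 1%N 2%N 0%N isT isT isT isT.
have [p3 g3] := E 1%N 1%N 2%N 2%N isT isT isT isT.
have [p4 g4] := E 1%N 2%N 2%N 0%N isT isT isT isT.
have [p5 g5] := E 1%N 2%N 2%N 1%N isT isT isT isT.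
(* The odd part: each of these three sums enters once for each of the three pairs [i < k], nine
   times in all. Every [aa], [ab] and negated [ab] enters an even number of times. *)
have b01 : (bb 0%N 1%N + bb 1%N 0%N = 1)%N by rewrite (anti 0%N 1%N) // addnC F.
have b02 : (bb 0%N 2%N + bb 2%N 0%N = 1)%N by rewrite (anti 0%N 2%N) // addnC F.
have b12 : (bb 1%N 2%N + bb 2%N 1%N = 1)%N by rewrite (anti 1%N 2%N) // addnC F.
have := F (ab 1%N 0%N); have := F (ab 1%N 1%N); have := F (ab 1%N 2%N).
have := F (ab 2%N 0%N); have := F (ab 2%N 1%N); have := F (ab 2%N 2%N).
move: e0 e1 e2 e3 e4 e5 f0 f1 f2 f3 f4 f5 g0 g1 g2 g3 g4 g5 b01 b02 b12.
clear.
repeat match goal with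
  |- context[nat_of_bool ?x] => move: (nat_of_bool x) => ? end.
lia.
Qed.

Lemma upper_sub (R : realType) (p q : R * R) :
  p != q -> upper (p - q) = ~~ upper (q - p).
Proof.
move=> pq; rewrite -opprB (@upperN _ (q - p)) //.
have : q - p != 0 by rewrite subr_eq0 eq_sym.
rewrite -normr_gt0 => h; apply: (@dot_near_gt0 _ 0).
  by rewrite mulr0.
by rewrite subrr normr0 mulr0.
Qed.

Lemma no_far_K33 (R : realType) (eps : R) (a b : nat -> R * R)
    (P : nat -> nat -> nat -> R * R) (n : nat -> nat -> nat) :
  0 <= eps ->
  (forall i j, (i < 3)%N -> (j < 3)%N ->
     [/\ P i j 0%N = a i, P i j (n i j) = b j
       & forall s, (s < n i j)%N -> `|P i j s.+1 - P i j s| <= eps]) ->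
  (forall i j k l s t, (i < 3)%N -> (j < 3)%N -> (k < 3)%N -> (l < 3)%N ->
     i != k -> j != l -> (s <= n i j)%N -> (t <= n k l)%N ->
     4 * eps < `|P i j s - P k l t|) ->
  False.
Proof.
move=> e0 chain far.
have neq (p q : R * R) : 4 * eps < `|p - q| -> p != q.
  move=> h; rewrite -subr_eq0 -normr_gt0.
  by apply: le_lt_trans h; rewrite mulr_ge0.
apply: (@van_kampen_K33 (fun i j k => view (a k) (P i j) (n i j))
  (fun i j l => view (b l) (P i j) (n i j))
  (fun j l => upper (a l - a j)) (fun j l => upper (b l - b j))
  (fun i l => upper (b l - a i))) => [i j i3 j3 ij|i j k l].
  apply/upper_sub/neq.
  have [_ <- _] := chain 0%N i isT i3; have [_ <- _] := chain 1%N j isT j3.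
  exact: far.
move=> /andP[ik k3] j3 l3 jl; have i3 := ltn_trans ik k3.
have [Pa Pb sP] := chain i j i3 j3; have [Qa Qb sQ] := chain k l k3 l3.
have ik' : i != k by rewrite ltn_eqF.
(* [view_grid] yields the direction from [b j] to [a k]; the table of directions records the
   opposite one. *)
have ab : upper (a k - b j) = ~~ upper (b j - a k).
  by apply/upper_sub; rewrite eq_sym -Qa -Pb; apply: neq; exact: far.
rewrite -ab -Qa -Qb -Pa -Pb (view_grid e0 sP sQ) //.
by move=> s t sn tn; apply: far.
Qed.

(** * Plane drawings of K_{3,3} *)

(** Heine-Cantor, from the near-covering form of compactness: half the radius that continuity gives
    at a point also serves at all points near it. *)
Lemma arc_uniform_continuity (R : realType) (g : R -> R * R) (eps : R) :
  {within `[0, 1]%classic, continuous g} -> 0 < eps ->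
  \forall d \near 0^'+, forall x y, x \in `[0, 1] -> y \in `[0, 1] ->
    `|x - y| <= d -> `|g x - g y| <= eps.
Proof.
move=> gc e0.
have cov := (near_covering_withinP _).2
  ((compact_near_coveringP _).1 (@segment_compact R 0 1)).
have H := cov R 0^'+ (fun d x => forall y, y \in `[0, 1] ->
    `|x - y| <= d -> `|g x - g y| <= eps)
  (@filter_filter _ _ (at_right_proper_filter 0)).
 apply: filterS (H _) => [d + x y xI yI|x xI].
  by apply.
move/subspace_continuousP: gc => /(_ x xI) /cvgrPdist_lt /(_ (eps / 2)).
rewrite divr_gt0 // => /(_ isT) /nbhs_ballP [r /= r0 xr].
have near_g y : y \in `[0, 1] -> `|x - y| < r -> `|g x - g y| < eps / 2.
  by move=> yI xy; apply: (xr y xy).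
have r20 : 0 < r / 2 by rewrite divr_gt0.
near=> x' d => x'I y yI xy.
have xx' : `|x - x'| < r / 2 
  by near: x'; apply/nbhs_ballP; exists (r / 2).
have dr : d <= r / 2 by near: d; exact: nbhs_right_le.
have -> : g x' - g y = (g x - g y) - (g x - g x') by ring.
apply: le_trans (ler_normB _ _) _.
have h1 : `|g x - g x'| < eps / 2 by apply: near_g => //; lra.
suff h2 : `|g x - g y| < eps / 2 by lra.
apply: near_g => //; have -> : x - y = (x - x') + (x' - y) by ring.
apply: le_lt_trans (ler_normD _ _) _.
by rewrite (splitr r) ltr_leD // (le_trans xy dr).
Unshelve. all: by end_near. Qed.

Definition eps_chain (R : realType) (A : set (R * R)) (eps : R) (p q : R * R)
    (f : nat -> R * R) (n : nat) : Prop :=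
  [/\ f 0%N = p, f n = q, forall s, (s < n)%N -> `|f s.+1 - f s| <= eps
    & forall s, (s <= n)%N -> A (f s)].

Lemma arc_chain (R : realType) (A : set (R * R)) (eps : R) (p q : R * R) :
  arc_between A p q -> 0 < eps -> exists f n, eps_chain A eps p q f n.
Proof.
move=> [g [gc _ g0 g1 ->]] e0.
have [d [d0 unif]] : exists d : R, 0 < d /\
    forall x y, x \in `[0, 1] -> y \in `[0, 1] ->
    `|x - y| <= d -> `|g x - g y| <= eps.
  have [r /= r0 H] := arc_uniform_continuity gc e0.
  exists (r / 2); split; first by rewrite divr_gt0.
  apply: H; rewrite /= ?divr_gt0 // sub0r normrN gtr0_norm ?divr_gt0 //.
  by rewrite ltr_pdivrMr // ltr_pMr // ltr1n.
(* This exceeds [d^-1], so consecutive sample points are at most [d] apart. *)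
pose n := (Num.truncn d^-1).+1.
have n0 : 0 < n%:R :> R by rewrite ltr0n.
have nd : n%:R^-1 <= d.
  by rewrite invf_ple ?posrE // ltW // truncnS_gt.
have nI s : (s <= n)%N -> s%:R / n%:R \in `[0, 1 : R].
  move=> sn; rewrite in_itv /= divr_ge0 // ler_pdivrMr // mul1r ler_nat //.
exists (fun s => g (s%:R / n%:R)), n; split.
- by rewrite mul0r.
- by rewrite divff // gt_eqF.
- move=> s sn; apply: unif; rewrite ?nI // 1?ltnW //.
  by rewrite -mulrBl -natrB // subSnn mul1r ger0_norm // invr_ge0 ltW.
- by move=> s sn; exists (s%:R / n%:R) => //; apply: nI.
Qed.

Lemma arc_compact (R : realType) (A : set (R * R)) (p q : R * R) :
  arc_between A p q -> compact A.
Proof.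
move=> [g [gc _ _ _ ->]].
by apply: continuous_compact => //; exact: segment_compact.
Qed.

(** Stated for all small [d] so that finitely many such gaps can be combined. *)
Lemma compact_disjoint_dist (R : realType) (A B : set (R * R)) :
  compact A -> compact B -> A `&` B `<=` set0 ->
  \forall d \near 0^'+, forall a b, A a -> B b -> d < `|a - b|.
Proof.
move=> cA cB AB.
have cov := (near_covering_withinP _).2 ((compact_near_coveringP _).1 cA).
have H := cov R 0^'+ (fun d a => forall b, B b -> d < `|a - b|)
  (@filter_filter _ _ (at_right_proper_filter 0)).
apply: filterS (H _) => [d + a b Aa Bb|a Aa]; first by apply.
have /closed_openC oB : closed B.
  by apply: compact_closed => //; exact: norm_hausdorff.
have Ba : (~` B)%classic a by move=> Ba; apply: (AB a).
have /nbhs_ballP [r /= r0 xr] := oB a Ba.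
have r20 : 0 < r / 2 by rewrite divr_gt0.
near=> a' d => Aa' b Bb.
have aa' : `|a - a'| < r / 2.
  by near: a'; apply/nbhs_ballP; exists (r / 2) => //= x; rewrite -ball_normE.
have dr : d < r / 2 by near: d; exact: nbhs_right_lt.
have ab : r <= `|a - b|.
  rewrite leNgt; apply/negP => abr; apply: (xr b) => //.
  by rewrite -ball_normE.
apply: lt_le_trans dr _; rewrite -(lerD2l (r / 2)) -splitr.
apply: le_trans ab _; have -> : a - b = (a - a') + (a' - b) by ring.
by apply: le_trans (ler_normD _ _) _; rewrite lerD2r ltW.
Unshelve. all: by end_near. Qed.

Lemma eps_chain_sub (R : realType) (A B : set (R * R)) (eps : R) (p q : R * R)
    (f : nat -> R * R) (n : nat) :
  A `<=` B -> eps_chain A eps p q f n -> eps_chain B eps p q f n.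
Proof. by move=> AB [? ? ? fA]; split=> // s /fA /AB. Qed.

Lemma eps_chain_cat (R : realType) (A : set (R * R)) (eps : R) (p q r : R * R)
    (f g : nat -> R * R) (n m : nat) :
  eps_chain A eps p q f n -> eps_chain A eps q r g m ->
  eps_chain A eps p r (fun s => if (s <= n)%N then f s else g (s - n)%N) (n + m).
Proof.
move=> [f0 fn fs fA] [g0 gm gs gA]; split=> //=.
- case: (posnP m) => [m0|m0]; last by
    rewrite -[X in (_ <= X)%N]addn0 leq_add2l leqNgt m0 addKn.
  by rewrite m0 addn0 leqnn fn -gm m0 g0.
- move=> s; case: (ltngtP s n) => [sn|sn|->] snm; first exact: fs.
    by rewrite subSn 1?ltnW //; apply: gs; lia.
  by rewrite subSnn fn -g0; apply: gs; lia.
- move=> s snm; case: leqP => sn; first exact: fA.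
  by apply: gA; rewrite leq_subLR.
Qed.

(** Any walk inside [W] is drawn in this set, so separating walks reduces to the disjointness of
    vertex sets. *)
Definition road (R : realType) (V : finType) (e : rel V)
    (edge : V -> V -> set (R * R)) (W : pred V) : set (R * R) :=
  [set p | exists x y, [/\ W x, W y, e x y & edge x y p]].

(** The walk must have an edge: the point of a lone vertex need not lie on the road. *)
Lemma path_chain (R : realType) (V : finType) (e : rel V) (pos : V -> R * R)
    (edge : V -> V -> set (R * R)) (eps : R) (W : pred V) (x : V) (s : seq V) :
  (forall u v, e u v -> arc_between (edge u v) (pos u) (pos v)) -> 0 < eps ->
  path e x s -> all W (x :: s) -> s != [::] ->
  exists f n, eps_chain (road e edge W) eps (pos x) (pos (last x s)) f n.
Proof.
move=> arc e0; elim: s x => // y s IHs x /= /andP[exy ys] /and3P[Wx Wy Ws] _.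
have [f [n fxy]] := arc_chain (arc _ _ exy) e0.
have {}fxy : eps_chain (road e edge W) eps (pos x) (pos y) f n.
  by apply: eps_chain_sub fxy => p pxy; exists x, y.
have [->|s0] := eqVneq s [::]; first by exists f, n.
have [|g [m gys]] := IHs y ys _ s0; first by rewrite /= Wy.
by eexists; eexists; exact: eps_chain_cat fxy gys.
Qed.

(** Two edges with four distinct ends have disjoint compact arcs: a common point would be the
    position of a vertex that is an end of both. There are finitely many pairs of edges, so one gap
    serves all of them. *)
Lemma drawing_gap (R : realType) (V : finType) (e : rel V) (pos : V -> R * R)
    (edge : V -> V -> set (R * R)) :
  plane_drawing e pos edge ->
  \forall d \near 0^'+, forall W W' : pred V, (forall z, W z -> ~~ W' z) ->
    forall p q, road e edge W p -> road e edge W' q -> d < `|p - q|.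
Proof.
move=> [pos_inj _ arc ends meet].
pose far (z : V * V * V * V) (d : R) := let: (x, y, u, v) := z in
  e x y -> e u v -> [&& x != u, x != v, y != u & y != v] ->
  forall p q, edge x y p -> edge u v q -> d < `|p - q|.
have gap (z : V * V * V * V) : \forall d \near 0^'+, far z d.
  rewrite /far; case: z => [[[x y] u] v] /=.
  have [exy|] := boolP (e x y); last by move=> _; near=> d.
  have [euv|] := boolP (e u v); last by move=> _; near=> d.
  have [/and4P[xu xv yu yv]|] := boolP [&& x != u, x != v, y != u & y != v];
    last by move=> _; near=> d.
  suff : \forall d \near 0^'+, forall p q, edge x y p -> edge u v q ->
      d < `|p - q| by apply: filterS => d H _ _ _.
  apply: compact_disjoint_dist.
  - exact: arc_compact (arc _ _ exy).
  - exact: arc_compact (arc _ _ euv).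
  move=> p [pxy puv].
  have [|w _ wp] := meet _ _ _ _ exy euv _ p (conj pxy puv).
    move=> H; have : [set u; v] x by rewrite -H; left.
    by case=> h; [move: xu|move: xv]; rewrite h eqxx.
  rewrite -wp in pxy puv.
  by case: (ends _ _ _ exy pxy) (ends _ _ _ euv puv) xu xv yu yv => ->;
    case=> ->; rewrite eqxx.
have : \forall d \near 0^'+, forall z, far z d by apply: filter_forall.
apply: filterS => d dgap W W' WW' p q.
move=> [x [y [Wx Wy exy pxy]]] [u [v [Wu Wv euv quv]]].
have WN a b : W a -> W' b -> a != b.
  by move=> Wa; apply: contraTneq => <-; exact: WW'.
by apply: (dgap (x, y, u, v)) => //; rewrite !WN.
Unshelve. all: by end_near. Qed.

(** Walks with a common index may overlap freely: the parity argument compares only independent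
    pairs. *)
Lemma planar_no_K33 (R : realType) (V : finType) (e : rel V) (a b : nat -> V)
    (W : nat -> nat -> pred V) :
  planar R e ->
  (forall i j, (i < 3)%N -> (j < 3)%N ->
     exists s, [/\ path e (a i) s, last (a i) s = b j & all (W i j) (a i :: s)]) ->
  (forall i j k l, (i < 3)%N -> (j < 3)%N -> (k < 3)%N -> (l < 3)%N ->
     i != k -> j != l -> forall z, W i j z -> ~~ W k l z) ->
  False.
Proof.
move=> [pos [edge drawing]] walk disj.
have [_ _ arc _ _] := drawing.
have [eps [e0 gap]] : exists eps : R, 0 < eps /\ forall W W' : pred V,
    (forall z, W z -> ~~ W' z) -> forall p q, road e edge W p ->
    road e edge W' q -> 4 * eps < `|p - q|.
  have [r /= r0 H] := drawing_gap drawing.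
  have r2 : 0 < r / 2 by rewrite divr_gt0.
  exists (r / 2 / 4); split; first by rewrite divr_gt0.
  rewrite mulrC divfK //; apply: H => //=.
  by rewrite sub0r normrN gtr0_norm // ltr_pdivrMr // ltr_pMr // ltr1n.
have ends i j : (i < 3)%N -> (j < 3)%N -> W i j (a i) /\ W i j (b j).
  move=> i3 j3; have [s [_ <- /allP Ws]] := walk i j i3 j3.
  by split; apply: Ws; rewrite ?mem_head ?mem_last.
(* Needed to have nonempty walks. A common point of the two sides would lie on two independent
   walks. *)
have ab i j : (i < 3)%N -> (j < 3)%N -> a i != b j.
  move=> i3 j3; apply/eqP => aibj.
  have [k k3 ik] : exists2 k, (k < 3)%N & i != k.
    by case: i {i3 aibj} => [|i]; [exists 1%N|exists 0%N].
  have [l l3 jl] : exists2 l, (l < 3)%N & j != l.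
    by case: j {j3 aibj} => [|j]; [exists 1%N|exists 0%N].
  have [Wa _] := ends i l i3 l3; have [_ Wb] := ends k j k3 j3.
  have := disj i l k j i3 l3 k3 j3 ik _ _ Wa.
  by rewrite eq_sym aibj => /(_ jl); rewrite Wb.
have chain (z : 'I_3 * 'I_3) : exists P : (nat -> R * R) * nat,
    eps_chain (road e edge (W z.1 z.2)) eps (pos (a z.1)) (pos (b z.2)) P.1 P.2.
  case: z => i j /=; have [s [es sb Ws]] := walk i j (ltn_ord i) (ltn_ord j).
  have [|f [n]] := path_chain arc e0 es Ws.
    apply: contraNneq (ab i j (ltn_ord i) (ltn_ord j)) => s0.
    by rewrite -sb s0.
  by rewrite sb => H; exists (f, n).
have [P HP] := fin_all_exists chain.
have PE i j (i3 : (i < 3)%N) (j3 : (j < 3)%N) :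
    eps_chain (road e edge (W i j)) eps (pos (a i)) (pos (b j))
      (P (inord i, inord j)).1 (P (inord i, inord j)).2.
  by have := HP (inord i, inord j); rewrite /= !inordK.
apply: (@no_far_K33 R eps (pos \o a) (pos \o b)
  (fun i j => (P (inord i, inord j)).1) (fun i j => (P (inord i, inord j)).2)).
- exact: ltW.
- by move=> i j i3 j3; have [] := PE i j i3 j3.
move=> i j k l s t i3 j3 k3 l3 ik jl sn tn.
have [_ _ _ /(_ s sn) Ps] := PE i j i3 j3.
have [_ _ _ /(_ t tn) Pt] := PE k l k3 l3.
exact: gap (disj _ _ _ _ i3 j3 k3 l3 ik jl) _ _ Ps Pt.
Qed.

(** * Rooted trees *)

(** The root is its own parent, so that [par] is total and ancestors are the points of its
    orbits. *)
Record rooted (V : finType) (t : rel V) (r : V) (par : V -> V)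
    (d : V -> nat) : Prop := Rooted {
  par_root : par r = r;
  depth_root : d r = 0%N;
  depth_par : forall x, x != r -> d x = (d (par x)).+1;
  edge_par : forall x y,
    t x y = (x != r) && (par x == y) || (y != r) && (par y == x) }.

(** Otherwise a duplicate-free path avoiding the edge would close up with it to a cycle with at
    least 3 vertices. *)
Lemma tree_bridge (V : finType) (t : rel V) (x y : V) :
  tree t -> t x y ->
  ~~ connect [rel a b | t a b && ~~ ((a == x) && (b == y) || (a == y) && (b == x))]
       x y.
Proof.
move=> [[tsym tirr] _ _ acyclic] txy; apply/negP => /connectP[p xp yp].
case/shortenP: xp yp => p' xp' up' _ yp'.
have : ucycle t (x :: p').
  rewrite /ucycle; apply/andP; split=> //=; rewrite rcons_path -yp' tsym txy andbT.
  by apply: sub_path xp' => a b /andP[].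
move/acyclic; case: p' xp' up' yp' => [_ _ yx|z [|? ?]] //=.
  by rewrite yx tirr in txy.
by move=> /andP[/andP[_ +] _] _ yz; rewrite yz !eqxx.
Qed.

(** Take for [d] the length of a shortest walk from [r]; the last but one vertex of such a walk is
    the required neighbour. *)
Lemma bfs_depth (V : finType) (t : rel V) (r : V) :
  (forall x, connect t r x) ->
  exists d : V -> nat, d r = 0%N /\
    forall x, x != r -> exists2 y, t y x & d x = (d y).+1.
Proof.
move=> conn.
have walk x : exists n, `[< exists p, [/\ path t r p, last r p = x & size p = n] >].
  by have /connectP[p rp ->] := conn x; exists (size p); apply/asboolP; exists p.
pose d x := ex_minn (walk x).
have dP x : exists p, [/\ path t r p, last r p = x & size p = d x].
  by rewrite /d; case: ex_minnP => n /asboolP.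
have dle x p : path t r p -> last r p = x -> (d x <= size p)%N.
  move=> rp px; rewrite /d; case: ex_minnP => n _; apply.
  by apply/asboolP; exists p.
exists d; split; first by apply/eqP; rewrite -leqn0; exact: (dle r [::]).
move=> x xr; have [p [rp px pd]] := dP x.
case/lastP: p rp px pd => [_ /= rx|p z]; first by rewrite rx eqxx in xr.
rewrite rcons_path last_rcons size_rcons => /andP[rp tz] zx pd; subst z.
exists (last r p) => //; apply/eqP; rewrite eqn_leq -{2}pd ltnS dle // andbT.
have [q [rq qx <-]] := dP (last r p).
by rewrite -(size_rcons q x) dle ?last_rcons // rcons_path rq qx.
Qed.

(** A neighbour one level closer to [r] is chosen as parent. A tree edge not of this kind could be
    deleted without cutting its ends off from [r], contradicting [tree_bridge]. *)
Lemma tree_rooted (V : finType) (t : rel V) (r : V) :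
  tree t -> exists par d, rooted t r par d.
Proof.
move=> tt; have [[tsym tirr] _ conn _] := tt.
have [d [d0 dS]] := bfs_depth (conn r).
pose par x := if x == r then r else odflt r [pick y | t y x && (d x == (d y).+1)].
have parP x : x != r -> t (par x) x /\ d x = (d (par x)).+1.
  move=> xr; rewrite /par (negbTE xr); case: pickP => [y /andP[? /eqP]|] //=.
  by have [y tyx dy] := dS x xr => /(_ y); rewrite tyx dy eqxx.
exists par, d; split=> // [|x xr|x y]; first by rewrite /par eqxx.
  by case: (parP x xr).
apply/idP/idP => [txy|/orP[]/andP[xr /eqP<-]]; first last.
- by case: (parP y xr).
- by rewrite tsym; case: (parP x xr).
apply/negPn/negP; rewrite negb_or => /andP[xy yx].
have := tree_bridge tt txy; set t' := [rel a b | _].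
have t'sym : symmetric t'.
  move=> a b; rewrite /t' /= tsym; congr (_ && ~~ _).
  by rewrite orbC [(b == x) && _]andbC [(b == y) && _]andbC.
have t'r z : connect t' r z.
  elim: {z}(d z) {-2}z (erefl (d z)) => [|n IHn] z dz;
    (have [->|zr] := eqVneq z r; first exact: connect0).
    by have [_] := parP z zr; rewrite dz.
  have [tz dz'] := parP z zr; apply: connect_trans (IHn (par z) _) (connect1 _).
    by move: dz'; rewrite dz => -[].
  rewrite /t' /= tz /=; apply/negP => /orP[] /andP[/eqP pz /eqP zy].
    by move: yx; rewrite -zy zr pz eqxx.
  by move: xy; rewrite -zy zr pz eqxx.
have t'C : connect_sym t' by exact: sym_connect_sym.
by case/negP; apply: connect_trans (t'r y); rewrite t'C.
Qed.

(** The first vertex is the upper one, and every vertex is above itself. *)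
Definition anc (V : finType) (par : V -> V) (v w : V) : bool := fconnect par w v.

Lemma anc_refl (V : finType) (par : V -> V) (v : V) : anc par v v.
Proof. exact: connect0. Qed.

Lemma anc_trans (V : finType) (par : V -> V) (u v w : V) :
  anc par u v -> anc par v w -> anc par u w.
Proof. by move=> uv vw; exact: connect_trans vw uv. Qed.

Lemma anc_par (V : finType) (par : V -> V) (v : V) : anc par (par v) v.
Proof. exact: fconnect1. Qed.

Lemma anc_iter (V : finType) (par : V -> V) (v w : V) :
  anc par v w -> exists n, iter n par w = v.
Proof. by move=> wv; exists (findex par w v); exact: iter_findex. Qed.

Lemma anc_step (V : finType) (par : V -> V) (v w : V) :
  anc par v w -> v = w \/ anc par v (par w).
Proof.
case/anc_iter=> -[|n] /= nv; [by left | right; rewrite -nv -iterS iterSr].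
exact: fconnect_iter.
Qed.

(** The clause [y != v] matters at the root, which would otherwise be its own child. *)
Lemma anc_child (V : finType) (par : V -> V) (v w : V) :
  anc par v w -> v != w -> exists2 y, par y = v /\ anc par y w & y != v.
Proof.
move/anc_iter => [n]; elim: n w => [|n IHn] w /= nv; first by rewrite nv eqxx.
move=> vw; have [v'|v'] := eqVneq (iter n par w) v.
  by apply: IHn.
by exists (iter n par w); [split; [|exact: fconnect_iter]|].
Qed.

Lemma anc_root (V : finType) (t : rel V) (r : V) (par : V -> V) (d : V -> nat)
    (w : V) : rooted t r par d -> anc par r w.
Proof.
move=> rt; elim: {w}(d w) {-2}w (erefl (d w)) => [|n IHn] w dw;
  (have [->|wr] := eqVneq w r; first exact: anc_refl);
  have := depth_par rt wr; rewrite dw // => -[dn].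
by apply: anc_trans (anc_par _ w); exact: IHn.
Qed.

Lemma anc_depth (V : finType) (t : rel V) (r : V) (par : V -> V) (d : V -> nat)
    (v w : V) : rooted t r par d -> anc par v w -> v = w \/ (d v < d w)%N.
Proof.
move=> rt /anc_iter[n]; elim: n w => [|n IHn] w; first by left.
rewrite iterSr => /IHn vw; have [wr|wr] := eqVneq w r.
  by case: vw; rewrite wr (par_root rt); [left|right].
by right; rewrite (depth_par rt wr) ltnS; case: vw => [->|/ltnW].
Qed.

Lemma anc_eq (V : finType) (t : rel V) (r : V) (par : V -> V) (d : V -> nat)
    (v w : V) : rooted t r par d -> anc par v w -> (d w <= d v)%N -> v = w.
Proof. by move=> rt /(anc_depth rt)[//|]; rewrite ltnNge => /negP. Qed.

(** The ancestors of [w] form a chain, ordered by depth. *)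
Lemma anc_total (V : finType) (t : rel V) (r : V) (par : V -> V) (d : V -> nat)
    (u v w : V) : rooted t r par d ->
  anc par u w -> anc par v w -> (d u <= d v)%N -> anc par u v.
Proof.
move=> rt + + uv; case/anc_iter=> n; elim: n w => [|n IHn] w /= uw vw.
  by rewrite (anc_eq rt vw) ?uw ?anc_refl.
rewrite -iterS iterSr in uw; case: (anc_step vw) => [->|vw'].
  by rewrite -uw -iterSr; exact: fconnect_iter.
exact: IHn vw'.
Qed.

(** * Halin graphs rooted at a leaf *)

Lemma next_head (T : eqType) (r : T) (s : seq T) : next (r :: s) r = nth r s 0.
Proof. by rewrite next_nth mem_head /= eqxx. Qed.

(** For the last [n] the right side is the default value [r], which closes the cycle. *)
Lemma next_cons_nth (T : eqType) (r : T) (s : seq T) (n : nat) :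
  uniq (r :: s) -> (n < size s)%N ->
  next (r :: s) (nth r s n) = nth r s n.+1.
Proof.
move=> us ns; rewrite next_nth inE mem_nth // orbT.
by rewrite -[nth r s n]/(nth r (r :: s) n.+1) index_uniq.
Qed.

Lemma cycle_graph_rot (V : finType) (n : nat) (c : seq V) :
  uniq c -> cycle_graph (rot n c) =2 cycle_graph c.
Proof. by move=> uc x y; rewrite /cycle_graph !mem_rot !next_rot. Qed.

(* [s] lists the leaves other than [r] in their order on the cycle. *)
Record rooted_halin (V : finType) (e t : rel V) (r : V) (s : seq V)
    (par : V -> V) (d : V -> nat) : Prop := RootedHalin {
  rh_rooted : rooted t r par d;
  rh_sym : symmetric e;
  rh_uniq : uniq (r :: s);
  rh_size : (1 < size s)%N;
  rh_adj : forall x y, e x y = t x y || cycle_graph (r :: s) x y;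
  rh_leaf : forall x y, x \in s -> y != r -> par y != x;
  rh_root : exists2 v0, v0 \notin r :: s &
    forall y, y != r -> (par y == r) = (y == v0);
  rh_branch : forall v, v \notin r :: s -> exists y1 y2,
    [/\ y1 != y2, y1 != r, y2 != r, par y1 = v & par y2 = v] }.

(** Every leaf may be the root: the exclusion of boxicity 1 has to choose a particular one. *)
Lemma halin_rooted (R : realType) (V : finType) (e : rel V) :
  halin R e -> exists (t : rel V) (c : seq V),
  [/\ uniq c, (2 < size c)%N & forall r, r \in c -> exists s par d,
     rooted_halin e t r s par d /\ perm_eq c (r :: s)].
Proof.
move=> [[esym _] _ [t [c [tt deg2 [uc c3] leaf adj]]]]; exists t, c.
split=> // r rc; have [par [d rt]] := tree_rooted r tt.
have [n s cs] := rot_to rc; exists s, par, d.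
have us : uniq (r :: s) by rewrite -cs rot_uniq.
have mems x : (x \in r :: s) = (degree t x == 1%N) by rewrite -cs mem_rot leaf.
have [[tsym tirr] _ _ _] := tt.
have s2 : (1 < size s)%N by move: c3; rewrite -(size_rot n) cs.
have sr x : x \in s -> x != r.
  by move=> xs; apply: contraTneq xs => ->; case/andP: us.
have tpar x : x != r -> t x (par x) by move=> xr; rewrite (edge_par rt) xr eqxx.
have leafs x y : x \in s -> y != r -> par y != x.
  move=> xs yr; apply/eqP => yx.
  have /card1P[z xz] : degree t x == 1%N by rewrite -mems inE xs orbT.
  have /eqP zy : y == z.
    by have := xz y; rewrite !inE => <-; rewrite tsym -yx tpar.
  have /eqP zx : par x == z by have := xz (par x); rewrite !inE => <-; rewrite tpar ?sr.
  have := depth_par rt (sr _ xs); rewrite zx -zy (depth_par rt yr) yx; lia.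
split; last by rewrite -cs perm_sym perm_rot.
split=> //.
- by move=> x y; rewrite adj -cs cycle_graph_rot.
- have /card1P[v0 rv0] : degree t r == 1%N by rewrite -mems mem_head.
  have v0P y : y != r -> (par y == r) = (y == v0).
    move=> yr; have := rv0 y; rewrite !inE => <-.
    by rewrite (edge_par rt) eqxx yr.
  have v0r : v0 != r.
    by apply/eqP => v0r; have := rv0 v0; rewrite v0r !inE tirr eqxx.
  exists v0 => //; rewrite inE (negbTE v0r) /=; apply/negP => v0s.
  (* If [v0] were a leaf, nothing would hang below it, so it would be the only leaf besides [r]. *)
  have sv0 : {subset s <= [:: v0]}.
    move=> x xs; rewrite inE.
    have rx : r != x by rewrite eq_sym sr.
    have [y [yr yx] ynr] := anc_child (anc_root x rt) rx.
    have /eqP yv0 : y == v0 by rewrite -v0P // yr.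
    rewrite yv0 in yx; have [//|v0x] := eqVneq x v0.
    rewrite eq_sym in v0x; have [z [zv0 _] zN] := anc_child yx v0x.
    have zr : z != r by apply: contraNneq v0r => zr; rewrite -zv0 zr (par_root rt).
    by have := leafs v0 z v0s zr; rewrite zv0 eqxx.
  have /andP[_ us'] := us.
  by have := uniq_leq_size us' sv0; rewrite leqNgt s2.
- move=> v vc; have vr : v != r by apply: contraNneq vc => ->; rewrite mem_head.
  (* The degree is neither 1 nor 2, and the parent accounts for one neighbour, so at least two
     children remain. *)
  have : (1 < #|[predD1 [pred y | t v y] & par v]|)%N.
    have := cardD1 (par v) [pred y | t v y]; rewrite inE /= tpar //.
    move: vc (deg2 v); rewrite mems /degree => + + h; rewrite h.
    by case: #|_| => [|[|k]].
  case/card_gt1P => y1 [y2 [+ + y12]]; rewrite !inE !(edge_par rt) vr /=.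
  move=> /andP[/negPf y1v] + /andP[/negPf y2v].
  rewrite ![par v == _]eq_sym y1v y2v /= => /andP[y1r /eqP y1p] /andP[y2r /eqP y2p].
  by exists y1, y2.
Qed.

Section RootedHalinTheory.
Context (V : finType) (e t : rel V) (r : V) (s : seq V) (par : V -> V)
  (d : V -> nat).
Context (H : rooted_halin e t r s par d).

Local Notation anc := (anc par).

Lemma leaf_neq_root x : x \in s -> x != r.
Proof.
by move=> xs; apply: contraTneq xs => ->; have /andP[] := rh_uniq H.
Qed.

Lemma leaf_anc x w : x \in s -> anc x w -> w = x.
Proof.
move=> xs xw; apply/eqP; apply: contraTT xs; rewrite eq_sym => /(anc_child xw).
move=> [y [yx _] yN]; apply/negP => xs.
have yr : y != r.
  apply: contraNneq (leaf_neq_root xs) => yr.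
  by rewrite -yx yr (par_root (rh_rooted H)).
by have := rh_leaf H xs yr; rewrite yx eqxx.
Qed.

Lemma anc_rootE x : anc x r -> x = r.
Proof.
by move/anc_iter => [n <-]; elim: n => //= n ->; exact: par_root (rh_rooted H).
Qed.

Lemma root_child_anc : exists2 v0, v0 \notin r :: s &
  forall x, x != r -> anc v0 x.
Proof.
have [v0 v0c v0P] := rh_root H; exists v0 => // x xr.
rewrite eq_sym in xr.
have [y [/eqP yr yx] ynr] := anc_child (anc_root x (rh_rooted H)) xr.
by move: yr; rewrite v0P // => /eqP <-.
Qed.

(** A deepest vertex below [v] has no child, so it is a leaf. *)
Lemma desc_leaf v : v != r -> exists2 l, l \in s & anc v l.
Proof.
move=> vr; case: (@arg_maxnP _ v (anc v) d (anc_refl par v)) => l vl lmax.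
exists l => //; apply/negPn/negP => ls.
have lr : l != r by apply: contraNneq vr => lr; rewrite -(anc_rootE (x := v)) // -lr.
have [|y [_ [_ yr _ yl _]]] := rh_branch H (v := l).
  by rewrite inE negb_or lr.
have := lmax y (anc_trans vl _); rewrite (depth_par (rh_rooted H) yr) yl.
by rewrite /= ltnn => /(_ _)/negP; rewrite -{1}yl anc_par => /(_ isT).
Qed.

End RootedHalinTheory.

(** * Leaves below a vertex are consecutive *)

Definition joined (V : finType) (e : rel V) (W : pred V) (x y : V) : Prop :=
  exists s, [/\ path e x s, last x s = y & all W (x :: s)].

Lemma joined_sym (V : finType) (e : rel V) (W : pred V) (x y : V) :
  symmetric e -> joined e W x y -> joined e W y x.
Proof.
move=> esym [s [xs <- Ws]]; exists (rev (belast x s)); split.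
- by rewrite rev_path; apply: sub_path xs => a b; rewrite esym.
- by case: s {xs Ws} => //= z s; rewrite rev_cons last_rcons.
- by rewrite -rev_rcons -lastI all_rev.
Qed.

Lemma joined_iota (V : finType) (e : rel V) (W : pred V) (f : nat -> V)
    (n m : nat) :
  (n <= m)%N -> (forall k, (n <= k < m)%N -> e (f k) (f k.+1)) ->
  (forall k, (n <= k <= m)%N -> W (f k)) -> joined e W (f n) (f m).
Proof.
move=> /subnK <-; elim: (m - n)%N => [|k IHk] ef Wf.
  by exists [::]; rewrite /= Wf ?leqnn.
have [l le|l le|p [xp px Wp]] := IHk; [apply: ef; lia|apply: Wf; lia|].
exists (rcons p (f (k.+1 + n)%N)); rewrite last_rcons rcons_path xp px.
split=> //; first by apply: ef; lia.
by rewrite -rcons_cons all_rcons Wp Wf; lia.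
Qed.

Section Contiguity.
Context (V : finType) (e t : rel V) (r : V) (s : seq V) (par : V -> V)
  (d : V -> nat).
Context (H : rooted_halin e t r s par d).

Local Notation anc := (anc par).
Local Notation leaf := (nth r s).

Lemma edge_to_par x : x != r -> e x (par x).
Proof.
by move=> xr; rewrite (rh_adj H) (edge_par (rh_rooted H)) xr eqxx.
Qed.

Lemma edge_head : e r (leaf 0).
Proof.
have s1 := rh_size H.
rewrite (rh_adj H) /cycle_graph mem_head next_head eqxx inE mem_nth ?orbT //.
exact: ltnW.
Qed.

(** For the last leaf, [leaf n.+1] is the default value [r]: this is the closing edge of the
    cycle. *)
Lemma edge_leaf n : (n < size s)%N -> e (leaf n) (leaf n.+1).
Proof.
move=> ns; rewrite (rh_adj H) /cycle_graph next_cons_nth ?(rh_uniq H) // eqxx.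
rewrite inE mem_nth // orbT /= andbT orbC.
case: (ltngtP n.+1 (size s)) ns => // [ns _|-> _].
  by rewrite inE mem_nth ?orbT.
by rewrite nth_default ?mem_head ?orbT.
Qed.

(* This includes n = size s, where [leaf] takes its default value r. *)
Lemma index_leaf n : (n <= size s)%N -> index (leaf n) s = n.
Proof.
have /andP[rs us] := rh_uniq H.
rewrite leq_eqVlt => /orP[/eqP->|ns]; last exact: index_uniq.
by rewrite nth_default //; apply/eqP; rewrite eqn_leq index_size leqNgt index_mem.
Qed.

Lemma mem_leaf n : leaf n \in r :: s.
Proof.
case: (ltnP n (size s)) => ns; first by rewrite inE mem_nth ?orbT.
by rewrite nth_default ?mem_head.
Qed.

Lemma joined_up p x :
  anc p x -> joined e (fun z => anc p z && anc z x) x p.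
Proof.
elim: {x}(d x) {-2}x (erefl (d x)) => [|n IHn] x dx px;
  (have [->|xp] := eqVneq x p; first by exists [::]; rewrite /= !anc_refl);
  have xr : x != r
    by (apply: contraNneq xp => xr; subst x; rewrite (anc_rootE H px)).
  by rewrite (depth_par (rh_rooted H) xr) in dx.
have [pE|pp] := anc_step px; first by rewrite pE eqxx in xp.
have [|q [xq qp Wq]] := IHn (par x) _ pp.
  by move: dx; rewrite (depth_par (rh_rooted H) xr) => -[].
exists (par x :: q); split=> //=; first by rewrite edge_to_par.
rewrite px anc_refl; apply: sub_all Wq => z /andP[-> zx] /=.
exact: anc_trans zx (anc_par _ _).
Qed.

Lemma lca x y : exists p,
  [/\ anc p x, anc p y & forall z, anc z x -> anc z y -> anc z p].
Proof.
have rt := rh_rooted H.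
have rxy : anc r x && anc r y by rewrite !(anc_root _ rt).
case: (@arg_maxnP _ r (fun z => anc z x && anc z y) d rxy) => p /andP[px py] pmax.
exists p; split=> // z zx zy.
by apply: (anc_total rt zx px); apply: pmax; rewrite zx zy.
Qed.

(* If the leaf b = leaf j is not below v, then a, c, q and b, r, p are the two
   sides of a subdivided K_{3,3}, where a = leaf i, c = leaf m, p is the lowest
   common ancestor of a and c, and q that of p and b. *)
Lemma contiguous (R : realType) (v : V) (i j m : nat) :
  planar R e -> v \notin r :: s -> (i < j < m)%N -> (m < size s)%N ->
  anc v (leaf i) -> anc v (leaf m) -> anc v (leaf j).
Proof.
move=> planar_e vc /andP[ij jm] ms va vm; apply/negPn/negP => vj.
have im := ltn_trans ij jm.
have js := ltn_trans jm ms; have is_ := ltn_trans ij js.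
pose a := leaf i; pose b := leaf j; pose c := leaf m.
have as_ : a \in s by exact: mem_nth.
have bs : b \in s by exact: mem_nth.
have cs : c \in s by exact: mem_nth.
have ia : index a s = i by rewrite index_leaf // ltnW.
have ib : index b s = j by rewrite index_leaf // ltnW.
have ic : index c s = m by rewrite index_leaf // ltnW.
have ir : index r s = size s.
  by have := index_leaf (leqnn (size s)); rewrite nth_default.
have vr : v != r by apply: contraNneq vc => ->; rewrite mem_head.
have [p [pa pc pmax]] := lca a c; have vp := pmax _ va vm.
have [q [qp qb qmax]] := lca p b.
have rt := rh_rooted H.
have pr : p != r by apply: contraNneq vr => pr; apply/eqP/(anc_rootE H); rewrite -pr.
have ps : p \notin s.
  apply/negP => ps; have ap := leaf_anc H ps pa; have cp := leaf_anc H ps pc.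
  by move: im; rewrite -ia -ic -/a -/c ap cp ltnn.
(* The only child of the root is above both [p] and [b], hence above [q]. *)
have qr : q != r.
  have [v0 v0c v0anc] := root_child_anc H.
  have v0q : anc v0 q by apply: qmax; apply: v0anc => //; exact: (leaf_neq_root H bs).
  apply: contraNneq v0c => qr; rewrite qr in v0q.
  by rewrite (anc_rootE H v0q) mem_head.
have qs : q \notin s.
  apply/negP => qs; have bq := leaf_anc H qs qb; have pq := leaf_anc H qs qp.
  by case/negP: vj; rewrite -/b bq -pq.
have rs : r \notin s by case/andP: (rh_uniq H).
(* [up x y] is the tree path from [x] up to [y], and [arc n k] the stretch of the cycle from
   [leaf n] to [leaf k]; as [r] has index [size s], it counts as the last leaf. *)
pose up x y := [pred z | anc y z && anc z x].
pose arc n k := [pred z | (z \in r :: s) && (n <= index z s <= k)%N].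
(* Rows belong to a, c, q and columns to b, r, p. The walk from a to r goes back along the cycle
   through [leaf 0], so [r] has to be added to its arc. *)
pose W k l : pred V :=
  nth pred0 (nth [::] [::
    [:: arc i j; predU1 r (arc 0%N i); up a p];
    [:: arc j m; arc m (size s); up c p];
    [:: up b q; up q r; up p q]] k) l.
have e_sym := rh_sym H.
have joined_arc n k : (n <= k <= size s)%N -> joined e (arc n k) (leaf n) (leaf k).
  move=> /andP[nk ks]; apply: joined_iota => // l /andP[nl lk].
    exact: edge_leaf (leq_trans lk ks).
  by rewrite /arc /= mem_leaf index_leaf ?nl // (leq_trans lk).
apply: (@planar_no_K33 R V e (nth r [:: a; c; q]) (nth r [:: b; r; p]) W)
  planar_e _ _.
- have ae : joined e (predU1 r (arc 0%N i)) a r.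
    apply: joined_sym => //.
    have [|w [w0 wa Ww]] := joined_arc 0%N i; first exact: ltnW.
    exists (leaf 0 :: w); split=> //=; first by rewrite edge_head.
    rewrite eqxx /=; apply: sub_all Ww => z /= ->; exact: orbT.
  have ab : joined e (arc i j) a b.
    by apply: joined_arc; rewrite (ltnW ij) (ltnW js).
  have cb : joined e (arc j m) c b.
    by apply: joined_sym => //; apply: joined_arc; rewrite (ltnW jm) (ltnW ms).
  have cr : joined e (arc m (size s)) c r.
    by rewrite -[r in joined _ _ _ r](nth_default r (leqnn (size s)));
      apply: joined_arc; rewrite (ltnW ms) /=.
  have ap : joined e (up a p) a p by exact: joined_up.
  have cp : joined e (up c p) c p by exact: joined_up.
  have qb' : joined e (up b q) q b by apply/joined_sym/joined_up.
  have qr' : joined e (up q r) q r by apply/joined_up/(anc_root _ rt).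
  have qp' : joined e (up p q) q p by apply/joined_sym/joined_up.
  by case=> [|[|[|//]]] [|[|[|//]]].
have up_c x y z : y != r -> x \in s -> up x y z -> z \in r :: s -> z = x.
  move=> yr xs /andP[yz zx]; rewrite inE => /orP[/eqP zr|zs].
    by move: yr; rewrite -(anc_rootE H (x := y)) ?eqxx // -zr.
  by rewrite (leaf_anc H zs zx).
have up_i x y z : y != r -> x \notin r :: s -> up x y z -> z \in r :: s -> False.
  move=> yr xs /andP[yz zx]; rewrite inE => /orP[/eqP zr|zs].
    by move: yr; rewrite -(anc_rootE H (x := y)) ?eqxx // -zr.
  by move: xs; rewrite inE (leaf_anc H zs zx) zs orbT.
have up_r z : up q r z -> z \in r :: s -> z = r.
  move=> /andP[_ zq]; rewrite inE => /orP[/eqP //|zs].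
  by move: qs; rewrite (leaf_anc H zs zq) zs.
have pcyc : p \notin r :: s by rewrite inE negb_or pr.
(* A common vertex would be below [p], hence below [v], and above [b]. *)
have vup x y z : up x p z -> up b y z -> False.
  move=> /andP[pz _] /andP[_ zb]; case/negP: vj.
  exact: anc_trans (anc_trans vp pz) zb.
have vup' x y z : up x p z -> up q y z -> False.
  move=> /andP[pz _] /andP[_ zq]; case/negP: vj.
  exact: anc_trans (anc_trans vp pz) (anc_trans zq qb).
suff disj k1 l1 k2 l2 y : (k1 < k2 < 3)%N -> (l1 < 3)%N -> (l2 < 3)%N ->
    l1 != l2 -> W k1 l1 y -> W k2 l2 y -> False.
  move=> k1 l1 k2 l2 k13 l13 k23 l23 k12 l12 z Wz; apply/negP => Wz'.
  case: (ltngtP k1 k2) k12 => // k12 _.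
    by apply: (disj k1 l1 k2 l2 z) => //; rewrite k12.
  by apply: (disj k2 l2 k1 l1 z) => //; rewrite ?k12 // eq_sym.
have arc_up n k x z z' : z' != r -> x \in s -> ~~ (n <= index x s <= k)%N ->
    arc n k z -> up x z' z -> False.
  move=> zr xs xnk /andP[zc znk] xz.
  by move: xnk; rewrite -(up_c _ _ _ zr xs xz zc) znk.
have arc_upi n k z : arc n k z -> up p q z -> False.
  by move=> /andP[zc _] pqz; exact: up_i qr pcyc pqz zc.
have arc_upr n k z : (k < size s)%N -> arc n k z -> up q r z -> False.
  move=> ks /andP[zc /andP[_ zk]] qrz; move: zk.
  by rewrite (up_r z qrz zc) ir leqNgt ks.
have head_arcE z : predU1 r (arc 0%N i) z ->
    z \in r :: s /\ (z = r \/ (index z s <= i)%N).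
  move=> /orP[/eqP ->|/andP[zc /andP[_ zi]]]; last by split=> //; right.
  by split; [exact: mem_head|left].
have head_arc_up x z z' : z' != r -> x \in s -> (i < index x s)%N ->
    predU1 r (arc 0%N i) z -> up x z' z -> False.
  move=> zr xs ix /head_arcE[zc zi] xz; move: ix; rewrite ltnNge => /negP; apply.
  have zx := up_c _ _ _ zr xs xz zc; rewrite -zx; case: zi => // zr'.
  by move: rs; rewrite -zr' zx xs.
(* The 18 independent pairs, six for each of the row pairs (a, c), (a, q) and (c, q). *)
case: k1 => [|[|k1]]; case: k2 => [|[|[|k2]]]; rewrite ?andbF //;
  case: l1 => [|[|[|l1]]] //; case: l2 => [|[|[|l2]]] // _ _ _ _;
  rewrite /W; cbn [nth].
- move=> /andP[_ /andP[_ yj]] /andP[_ /andP[my _]].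
  by have := leq_trans my yj; rewrite leqNgt jm.
- by apply: arc_up; rewrite // ic (leqNgt m) jm andbF.
- move=> /head_arcE[_ [->|yi]] /andP[_ /andP[jy ym]].
    by move: ym; rewrite ir leqNgt ms.
  by have := leq_trans jy yi; rewrite leqNgt ij.
- by apply: head_arc_up; rewrite // ic.
- by move=> ya yjm; apply: (arc_up _ _ _ _ _ pr as_ _ yjm ya); rewrite ia leqNgt ij.
- by move=> ya yjm; apply: (arc_up _ _ _ _ _ pr as_ _ yjm ya); rewrite ia leqNgt im.
- exact: arc_upr.
- exact: arc_upi.
- by apply: head_arc_up; rewrite // ib.
- by move=> /head_arcE[yc _] ypq; exact: up_i qr pcyc ypq yc.
- exact: vup.
- exact: vup'.
- exact: arc_upr.
- exact: arc_upi.
- by apply: arc_up; rewrite // ib leqNgt jm.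
- exact: arc_upi.
- exact: vup.
- exact: vup'.
Qed.

End Contiguity.

(** * Boxes *)

(** Natural endpoints leave the comparisons of boxes to linear arithmetic. *)
Lemma box_representable2_nat (R : realType) (V : finType) (e : rel V)
    (x1 x2 y1 y2 : V -> nat) :
  (forall v, (x1 v <= x2 v)%N) -> (forall v, (y1 v <= y2 v)%N) ->
  (forall u v, u != v -> e u v =
     [&& x1 u <= x2 v, x1 v <= x2 u, y1 u <= y2 v & y1 v <= y2 u]%N) ->
  box_representable R e 2.
Proof.
move=> x12 y12 eE.
pose a v (i : 'I_2) : R := (if i == 0 then x1 v else y1 v)%:R.
pose b v (i : 'I_2) : R := (if i == 0 then x2 v else y2 v)%:R.
have ab v i : a v i <= b v i by rewrite /a /b ler_nat; case: ifP.
exists (fun v => [set p : 'rV[R]_2 | forall i, p ord0 i \in `[a v i, b v i]]).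
split=> [v|u v uv]; first by exists (a v), (b v).
rewrite (eE u v uv); split=> [/and4P[xuv xvu yuv yvu]|[p [/= pu pv]]].
  exists (\row_i Num.max (a u i) (a v i)); split=> i /=;
    rewrite mxE in_itv /= le_max lexx ?orbT /= ge_max ab ?andbT //=;
    by rewrite /a /b ler_nat; case: ifP.
have p0 := pu 0; have p1 := pu 1; have q0 := pv 0; have q1 := pv 1.
move: p0 p1 q0 q1; rewrite !in_itv /= /a /b /=.
move=> /andP[? ?] /andP[? ?] /andP[? ?] /andP[? ?].
by apply/and4P; split; rewrite -(ler_nat R); apply: le_trans; eassumption.
Qed.

Section Boxes.
Context (V : finType) (e t : rel V) (r : V) (s : seq V)
  (par : V -> V) (d : V -> nat).
Context (H : rooted_halin e t r s par d).

Local Notation anc := (anc par).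
Local Notation leaf := (nth r s).

(** These are the first and the last leaf. No tree edge joins two leaves of [s], so an edge between
    them is a cycle edge, and the cycle is a triangle. *)
Lemma leaf_edge_sides : exists y z,
  [/\ [/\ y \in s, z \in s & y != z], e r y /\ e r z & e y z -> size s = 2%N].
Proof.
have s2 := rh_size H; have s0 : (0 < size s)%N := ltnW s2.
have ks : ((size s).-1 < size s)%N by rewrite ltn_predL.
exists (leaf 0), (leaf (size s).-1); split.
- split; [exact: mem_nth|exact: mem_nth|].
  have /andP[_ us] := rh_uniq H.
  by rewrite nth_uniq //; clear -s2; lia.
- split; first exact: edge_head H.
  rewrite (rh_sym H); have := edge_leaf H ks.
  by rewrite prednK // (nth_default r (leqnn _)).
have nt u v : u \in s -> v \in s -> t u v = false.
  move=> us vs; have [ur vr] := (leaf_neq_root H us, leaf_neq_root H vs).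
  rewrite (edge_par (rh_rooted H)) ur vr /=.
  by rewrite (negbTE (rh_leaf H vs ur)) (negbTE (rh_leaf H us vr)).
have us : uniq s by have /andP[] := rh_uniq H.
have l0r := leaf_neq_root H (mem_nth r s0).
rewrite (rh_adj H) nt ?mem_nth //= => /and3P[_ _].
rewrite (next_cons_nth (rh_uniq H) s0) (next_cons_nth (rh_uniq H) ks).
rewrite prednK // (nth_default r (leqnn _)) (negbTE l0r) orbF.
by rewrite (nth_uniq r ks s2 us) => /eqP k1; rewrite -(prednK s0) k1.
Qed.

(** Below two distinct children lie distinct leaves: ancestors of one leaf at equal depth
    coincide. *)
Lemma two_leaves v : v \notin r :: s ->
  exists i m, [/\ (i < m < size s)%N, anc v (leaf i) & anc v (leaf m)].
Proof.
move=> vc; have rt := rh_rooted H.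
have [y1 [y2 [y12 y1r y2r y1v y2v]]] := rh_branch H vc.
have [l1 l1s yl1] := desc_leaf H y1r; have [l2 l2s yl2] := desc_leaf H y2r.
have vl1 : anc v l1 by rewrite -y1v; apply: anc_trans (anc_par _ _) yl1.
have vl2 : anc v l2 by rewrite -y2v; apply: anc_trans (anc_par _ _) yl2.
have dy : d y1 = d y2 by rewrite (depth_par rt y1r) (depth_par rt y2r) y1v y2v.
have l12 : l1 != l2.
  apply: contraNneq y12 => l12; rewrite -l12 in yl2.
  have := anc_total rt yl1 yl2; rewrite dy leqnn => /(_ isT) y12.
  by apply/eqP; apply: (anc_eq rt y12); rewrite dy.
case: (ltngtP (index l1 s) (index l2 s)) => i12.
- by exists (index l1 s), (index l2 s); rewrite !nth_index // i12 index_mem.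
- by exists (index l2 s), (index l1 s); rewrite !nth_index // i12 index_mem.
- by case/eqP: l12; rewrite -(nth_index r l1s) i12 nth_index.
Qed.

(** Another inner vertex would have both leaves below it, and so would the child of [v0] above it;
    but a second child of [v0] also needs a leaf. *)
Lemma tiny_vertices : size s = 2%N ->
  exists2 v0, v0 \notin r :: s & forall x, x \in v0 :: r :: s.
Proof.
move=> s2; have rt := rh_rooted H; have [v0 v0c v0anc] := root_child_anc H.
exists v0 => // v; rewrite inE; apply/norP => -[vv0 vc].
have vr : v != r by apply: contraNneq vc => ->; rewrite mem_head.
have v_all l : l \in s -> anc v l.
  have [i [m [im vi vm]]] := two_leaves vc; have [? ?] : i = 0%N /\ m = 1%N by lia.
  subst i m; rewrite -index_mem s2 => ls2; rewrite -(nth_index r (s := s) (x := l)).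
    by case: (index l s) ls2 => [|[|]].
  by rewrite -index_mem s2.
have v0v : v0 != v by rewrite eq_sym.
have [u [uv0 uv] uN] := anc_child (v0anc v vr) v0v.
have [y1 [y2 [y12 y1r y2r y1v y2v]]] := rh_branch H v0c.
have ur : u != r.
  by apply: contraNneq v0c => ur; rewrite -uv0 ur (par_root rt) mem_head.
have all_u y : y != r -> par y = v0 -> y = u.
  move=> yr yv0; have [l ls yl] := desc_leaf H yr.
  have dy : d y = d u by rewrite (depth_par rt yr) (depth_par rt ur) yv0 uv0.
  have yu : anc y u.
    by apply: (anc_total rt yl (anc_trans uv (v_all l ls))); rewrite dy.
  by apply: (anc_eq rt yu); rewrite dy.
by case/eqP: y12; rewrite (all_u y1) // (all_u y2).
Qed.

Lemma tiny_isomorphic : irreflexive e -> size s = 2%N ->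
  isomorphic e (@complete_graph 4).
Proof.
move=> eirr s2; have rt := rh_rooted H; have esym := rh_sym H.
have [v0 v0c all_v] := tiny_vertices s2.
have L4 : size (v0 :: r :: s) = 4%N by rewrite /= s2.
have uL : uniq (v0 :: r :: s) by rewrite cons_uniq v0c (rh_uniq H).
have v0l l : l \in r :: s -> e v0 l.
  move=> lc; rewrite (rh_adj H) (edge_par rt); move: lc; rewrite inE.
  have v0r : v0 != r by apply: contraNneq v0c => ->; rewrite mem_head.
  have [v1 v1c v1P] := rh_root H.
  have /eqP v01 : v0 == v1.
    have := all_v v1; rewrite inE (negbTE v1c) orbF => /eqP ->; exact: eqxx.
  case/orP => [/eqP ->|ls]; first by rewrite v0r v1P // v01 eqxx.
  have lr := leaf_neq_root H ls.
  have := all_v (par l); rewrite !inE v1P //.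
  case/or3P => [-> |/eqP lv1|pls]; first by rewrite lr /= !orbT.
    by move: v1c; rewrite -lv1 inE ls orbT.
  by have := rh_leaf H pls lr; rewrite eqxx.
have cyc x y : x \in r :: s -> y \in r :: s -> x != y -> e x y.
  move: (edge_head H) (edge_leaf H); case: s s2 => [|l1 [|l2 [|? ?]]] //= _.
  move=> er1 el; have e12 := el 0%N isT; have e2r := el 1%N isT.
  rewrite /= in e12 e2r; rewrite !inE.
  by case/or3P => /eqP ->; case/or3P => /eqP ->; rewrite ?eqxx // esym.
have eE x y : e x y = (x != y).
  have [->|xy] := eqVneq x y; first exact: eirr.
  move: (all_v x) (all_v y); rewrite (in_cons v0 _ x) (in_cons v0 _ y).
  have [xv0|_] := eqVneq x v0; have [yv0|_] := eqVneq y v0; rewrite /=.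
  - by rewrite xv0 yv0 eqxx in xy.
  - by rewrite xv0 => _; exact: v0l.
  - by rewrite yv0 esym => + _; exact: v0l.
  - by move=> xc yc; exact: cyc.
have iL x : (index x (v0 :: r :: s) < 4)%N by rewrite -L4 index_mem.
pose f x : 'I_4 := Ordinal (iL x).
have fI : injective f.
  by move=> x y /(congr1 val) /= xy; rewrite -(nth_index r (all_v x)) /= xy nth_index.
exists f; last by move=> x y; rewrite eE /complete_graph (inj_eq fI).
apply: inj_card_bij => //; rewrite card_ord -L4 -(card_uniqP uL).
exact: max_card.
Qed.

End Boxes.

(** * The representation by rectangles *)

Section BoxConstruction.
Context (R : realType) (V : finType) (e t : rel V) (r : V) (s : seq V)
  (par : V -> V) (d : V -> nat).
Context (H : rooted_halin e t r s par d).
Context (plane : planar R e) (s3 : (2 < size s)%N).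

Local Notation anc := (anc par).
Local Notation leaf := (nth r s).

(** If the two leaves found below [v] are the first and the last, contiguity puts [leaf 1] below [v]
    too, and it is not the last since [2 < size s]. *)
Lemma inner_leaf v : v \notin r :: s ->
  exists2 i, (0 < i < (size s).-1)%N & anc v (leaf i).
Proof.
move=> vc; have [i [m [/andP[im ms] vi vm]]] := two_leaves H vc.
have [i0|i0] := posnP i; last by exists i => //; clear -i0 im ms; lia.
have [m1|m1] := ltnP m (size s).-1; first by exists m => //; clear -im m1; lia.
exists 1%N; first by clear -s3; lia.
by apply: (contiguous H plane vc _ ms vi vm); clear -i0 m1 s3; lia.
Qed.

(* An internal vertex must avoid the two leaves next to the root, except when
   it is the parent of one of them: their boxes are long enough to reach the
   box of the root. *)
Definition spanned (v : V) (i : nat) : bool :=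
  [&& (i < size s)%N, anc v (leaf i)
    & (0 < i < (size s).-1)%N || (par (leaf i) == v)].

Lemma span_bounds : exists lo hi : V -> nat, forall v, v \notin r :: s ->
  [/\ spanned v (lo v), spanned v (hi v)
    & forall i, spanned v i -> (lo v <= i <= hi v)%N].
Proof.
have bounds v : exists p : nat * nat, v \notin r :: s ->
    [/\ spanned v p.1, spanned v p.2
      & forall i, spanned v i -> (p.1 <= i <= p.2)%N].
  have [vc|vc] := boolP (v \in r :: s); first by exists (0%N, 0%N).
  have ex : exists i, spanned v i.
    have [i i1 vi] := inner_leaf vc; exists i; rewrite /spanned vi i1 andbT.
    by clear -i1; lia.
  have ub i : spanned v i -> (i <= size s)%N by move=> /and3P[/ltnW].
  exists (ex_minn ex, ex_maxn ex ub) => _ /=.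
  case: ex_minnP => a sa amin; case: ex_maxnP => b sb bmax.
  by split=> // i si; rewrite amin //= bmax.
have [f fP] := fin_all_exists bounds.
by exists (fun v => (f v).1), (fun v => (f v).2).
Qed.

Lemma halin_box2 : box_representable R e 2.
Proof.
have [lo [hi span]] := span_bounds.
have rt := rh_rooted H.
have /andP[_ us] := rh_uniq H.
have [v0 v0c v0P] := rh_root H.
have leaf_root := leaf_neq_root H.
(* The common floor of the leaves, deeper than every vertex. *)
pose D := (\max_v d v).+1; have dD v : (d v < D)%N by exact: leq_bigmax.
pose ends i := (i == 0%N) || (i == (size s).-1).
(* Leaf number i occupies [2i, 2i + 2], so only consecutive leaves touch. Inner vertices end at the
   odd midpoints, out of reach of leaves outside their span. *)
pose x1 v := if v == r then 0%N else if v \in s then (index v s).*2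
  else (lo v).*2.+1.
pose x2 v := if v == r then (size s).*2 else if v \in s then (index v s).*2.+2
  else (hi v).*2.+1.
(* Inner boxes occupy one unit of depth and touch those of their children; the root has [0, 1], and
   the two end leaves start at 1 to touch it. *)
pose y1 v := if v == r then 0%N else
  if (v \in s) && ends (index v s) then 1%N else d v.
pose y2 v := if v == r then 1%N else if v \in s then D else (d v).+1.
pose meets u v := [&& x1 u <= x2 v, x1 v <= x2 u, y1 u <= y2 v & y1 v <= y2 u]%N.
have meetsC u v : meets u v = meets v u.
  by rewrite /meets; apply/and4P/and4P => -[].
have kindP v : [\/ v = r, v \in s | v \notin r :: s].
  rewrite inE; case: eqVneq => [|_]; first by constructor 1.
  by case: (boolP (v \in s)); [constructor 2|constructor 3].
have cE v : v \notin r :: s -> (v != r) /\ v \notin s.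
  by rewrite inE negb_or => /andP.
have d1 v : v != r -> (0 < d v)%N by move=> vr; rewrite (depth_par rt vr).
have lohi v : v \notin r :: s -> (lo v <= hi v < size s)%N.
  by move=> vc; have [sl /and3P[hs _ _] /(_ _ sl)/andP[_ ->]] := span v vc.
have par_anc u v : anc u v -> d v = (d u).+1 -> v != r -> par v = u.
  move=> uv duv vr; have [uE|up] := anc_step uv.
    by move: duv; rewrite uE; clear; lia.
  apply/esym/(anc_eq rt up); move: duv; rewrite (depth_par rt vr); clear; lia.
have between v i : v \notin r :: s -> (lo v <= i <= hi v)%N -> anc v (leaf i).
  move=> vc /andP[li ih]; have [/and3P[_ vl _] /and3P[hs vh _] _] := span v vc.
  move: li; rewrite leq_eqVlt => /orP[/eqP <- //|li].
  move: ih; rewrite leq_eqVlt => /orP[/eqP -> //|ih].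
  by apply: (contiguous H plane vc _ hs vl vh); rewrite li ih.
have e_int u v : v \notin r :: s -> e u v = t u v.
  by move=> vc; rewrite (rh_adj H) /cycle_graph (negbTE vc) andbF orbF.
have x1r : x1 r = 0%N by rewrite /x1 eqxx.
have x2r : x2 r = (size s).*2 by rewrite /x2 eqxx.
have y1r : y1 r = 0%N by rewrite /y1 eqxx.
have y2r : y2 r = 1%N by rewrite /y2 eqxx.
have leafE l : l \in s -> [/\ x1 l = (index l s).*2, x2 l = (index l s).*2.+2,
    y1 l = (if ends (index l s) then 1%N else d l) & y2 l = D].
  by move=> ls; rewrite /x1 /x2 /y1 /y2 (negbTE (leaf_root l ls)) ls.
have intE v : v \notin r :: s -> [/\ x1 v = (lo v).*2.+1, x2 v = (hi v).*2.+1,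
    y1 v = d v & y2 v = (d v).+1].
  move=> /cE[/negbTE vr /negbTE vs]; by rewrite /x1 /x2 /y1 /y2 vr vs.
have x12 v : (x1 v <= x2 v)%N.
  have [->|/leafE[-> -> _ _]|vc] := kindP v; first by rewrite x1r.
    by clear; lia.
  by have [-> -> _ _] := intE v vc; have := lohi v vc; clear; lia.
have y12 v : (y1 v <= y2 v)%N.
  have [->|/leafE[_ _ -> ->]|vc] := kindP v; first by rewrite y1r.
    by case: ifP => // _; exact: ltnW.
  by have [_ _ -> ->] := intE v vc.
(* The only child of the root is an inner vertex. So a leaf that is not stretched upwards stays
   clear of the root's box. *)
have leaf_depth l : l \in s -> (1 < d l)%N.
  move=> ls; rewrite (depth_par rt (leaf_root l ls)) ltnS d1 //.
  rewrite v0P ?leaf_root //; apply: contraNneq v0c => <-.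
  by rewrite inE ls orbT.
have no_leaf_par l x : l \in s -> x != r -> (par x == l) = false.
  by move=> ls xr; apply/negbTE/(rh_leaf H).
have index_lt l : l \in s -> (index l s < size s)%N by rewrite index_mem.
have nextE l : l \in s -> next (r :: s) l = leaf (index l s).+1.
  move=> ls; rewrite -{1}(nth_index r ls).
  by rewrite (next_cons_nth (rh_uniq H)) // index_lt.
have e_root_leaf l : l \in s -> e r l = meets r l.
  move=> ls; have lr := leaf_root l ls; have [xl1 xl2 yl1 yl2] := leafE l ls.
  have lv0 : (par l == r) = false.
    by rewrite v0P //; apply: contraNF v0c => /eqP <-; rewrite inE ls orbT.
  rewrite /meets x1r x2r y1r y2r xl1 xl2 yl1 yl2 /=.
  rewrite (rh_adj H) (edge_par rt) eqxx lr lv0 /=.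
  rewrite /cycle_graph next_head (nextE l ls) mem_head inE ls orbT /=.
  have il := index_lt l ls.
  have -> : (l == leaf 0) = (index l s == 0%N).
    by rewrite -{1}(nth_index r ls) nth_uniq //; exact: leq_trans il.
  have -> : (r == leaf (index l s).+1) = (index l s == (size s).-1).
    have [i1|i1] := ltnP (index l s).+1 (size s).
      rewrite eq_sym (negbTE (leaf_root _ (mem_nth r i1))).
      by apply/esym/negbTE; clear -i1; lia.
    by rewrite nth_default // eqxx; apply/esym/eqP; clear -i1 il; lia.
  have := leaf_depth l ls; rewrite -/(ends (index l s)).
  by case: (ends _) => dl; clear -il dl; lia.
have e_root_int v : v \notin r :: s -> e r v = meets r v.
  move=> vc; have [vr vs] := cE v vc; have [xv1 xv2 yv1 yv2] := intE v vc.
  rewrite /meets x1r x2r y1r y2r xv1 xv2 yv1 yv2 e_int // (edge_par rt).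
  rewrite eqxx vr /=.
  have -> : (par v == r) = (d v <= 1)%N.
    rewrite (depth_par rt vr); have [->|pr] := eqVneq (par v) r.
      by rewrite (depth_root rt).
    by have := d1 _ pr; clear; lia.
  by have := lohi v vc; clear; lia.
have e_leaf_leaf l l' : l \in s -> l' \in s -> (index l s < index l' s)%N ->
    e l l' = meets l l'.
  move=> ls ls' ll'; rewrite /meets.
  have [-> -> yl1 ->] := leafE l ls; have [-> -> yl1' ->] := leafE l' ls'.
  have [lr lr'] := (leaf_root l ls, leaf_root l' ls').
  rewrite (rh_adj H) (edge_par rt) lr lr' /= (no_leaf_par l) // (no_leaf_par l') //.
  rewrite /cycle_graph !inE ls ls' !orbT (nextE l ls) (nextE l' ls') /=.
  have [il il'] := (index_lt l ls, index_lt l' ls').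
  have yD k : k \in s -> (y1 k <= D)%N.
    by move=> ks; have := y12 k; have [_ _ _ ->] := leafE k ks.
  rewrite (yD l ls) (yD l' ls') !andbT.
  have -> : (l' == leaf (index l s).+1) = (index l' s == (index l s).+1).
    rewrite -{1}(nth_index r ls') nth_uniq //; exact: leq_ltn_trans il'.
  have -> : (l == leaf (index l' s).+1) = false.
    have [i1|i1] := ltnP (index l' s).+1 (size s).
      rewrite -{1}(nth_index r ls) nth_uniq //; clear -ll'; lia.
    by rewrite nth_default // (negbTE lr).
  by clear -ll'; lia.
have e_leaf_int l v : l \in s -> v \notin r :: s -> e l v = meets l v.
  move=> ls vc; have [vr vs] := cE v vc; have lr := leaf_root l ls.
  rewrite /meets; have [-> -> yl1 ->] := leafE l ls; have [-> -> -> ->] := intE v vc.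
  rewrite yl1 e_int // (edge_par rt) lr vr /= (no_leaf_par l) // orbF.
  have il := index_lt l ls; have leafi := nth_index r ls.
  have [slo shi sb] := span v vc.
  have -> : ((index l s).*2 <= (hi v).*2.+1)%N = (index l s <= hi v)%N.
    by clear; lia.
  have -> : ((lo v).*2.+1 <= (index l s).*2.+2)%N = (lo v <= index l s)%N.
    by clear; lia.
  have -> : (d v <= D)%N by exact: ltnW.
  rewrite andbT; apply/eqP/and3P => [plv|[lhi llo yl]].
    have /sb/andP[-> ->] : spanned v (index l s).
      by rewrite /spanned il leafi plv eqxx orbT andbT -plv anc_par.
    by split=> //; case: ifP => // _; rewrite (depth_par rt lr) plv.
  have vl : anc v l by rewrite -leafi; apply: between; rewrite // llo lhi.
  (* An end index within the span must be [lo v] or [hi v] itself, so it is spanned, which for an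
     end leaf means that [v] is its parent. *)
  have lends : ends (index l s) -> par l = v.
    move=> li; suff : spanned v (index l s).
      rewrite /spanned leafi => /and3P[_ _ /orP[|/eqP //]].
      by move: li; rewrite /ends; clear; lia.
    case/orP: li => /eqP li.
      by have -> : index l s = lo v; [clear -li llo; lia|].
    have -> // : index l s = hi v.
    by have := lohi v vc; clear -li lhi; lia.
  move: yl; case: ifP => [/lends //|_ dl].
  apply: par_anc => //; case: (anc_depth rt vl) => [vE|dv].
    by rewrite vE ls in vs.
  by apply/eqP; rewrite eqn_leq dl dv.
have e_int_int u v : u \notin r :: s -> v \notin r :: s -> u != v ->
    (d u <= d v)%N -> e u v = meets u v.
  move=> uc vc uv duv; have [[ur us'] [vr vs]] := (cE u uc, cE v vc).
  rewrite /meets; have [-> -> -> ->] := intE u uc; have [-> -> -> ->] := intE v vc.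
  rewrite e_int // (edge_par rt) ur vr /=.
  have -> : (par u == v) = false.
    apply/negbTE/eqP => uv'; move: duv; rewrite (depth_par rt ur) uv'; clear; lia.
  rewrite /=; apply/eqP/and4P => [pvu|[luhv lvhu _ dvu]].
    have dv : d v = (d u).+1 by rewrite (depth_par rt vr) pvu.
    (* A leaf below [v] that is not an end leaf is spanned by the parent [u] as well, so the two
       spans overlap. *)
    have [i i1 vi] := inner_leaf vc.
    have is_ : (i < size s)%N by clear -i1; lia.
    have ui : anc u (leaf i) by apply: anc_trans vi; rewrite -pvu anc_par.
    have [_ _ /(_ i)] := span u uc; rewrite /spanned is_ ui i1 => /(_ isT) bu.
    have [_ _ /(_ i)] := span v vc; rewrite /spanned is_ vi i1 => /(_ isT) bv.
    by split; clear -bu bv dv; lia.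
  (* If the spans overlap, this position is in both, so [u] and [v] have a common leaf below them
     and are comparable; the second coordinate then forces consecutive depths. *)
  pose i := maxn (lo u) (lo v); have [bu bv] := (lohi u uc, lohi v vc).
  have ui : anc u (leaf i).
    by apply: between => //; rewrite /i; clear -bu bv luhv lvhu; lia.
  have vi : anc v (leaf i).
    by apply: between => //; rewrite /i; clear -bu bv luhv lvhu; lia.
  have auv := anc_total rt ui vi duv.
  apply: par_anc => //; case: (anc_depth rt auv) => [uE|dv].
    by rewrite uE eqxx in uv.
  by apply/eqP; rewrite eqn_leq dv dvu.
apply: (@box_representable2_nat R V e x1 x2 y1 y2) => // u v uv.
rewrite -/(meets u v).
have e_sym := rh_sym H.
have [ur|us'|uc] := kindP u; have [vr|vs|vc] := kindP v.
- by rewrite ur vr eqxx in uv.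
- by rewrite ur e_root_leaf.
- by rewrite ur e_root_int.
- by rewrite vr e_sym meetsC e_root_leaf.
- case: (ltngtP (index u s) (index v s)) => uvi.
  + exact: e_leaf_leaf.
  + by rewrite e_sym meetsC e_leaf_leaf.
  + by case/eqP: uv; rewrite -(nth_index r us') uvi nth_index.
- exact: e_leaf_int.
- by rewrite vr e_sym meetsC e_root_int.
- by rewrite e_sym meetsC e_leaf_int.
- case/orP: (leq_total (d u) (d v)) => duv; first exact: e_int_int.
  by rewrite e_sym meetsC e_int_int // eq_sym.
Qed.

End BoxConstruction.

(** * Interval representations and the value of the boxicity *)

Lemma box_representable1_interval (R : realType) (V : finType) (e : rel V) :
  box_representable R e 1 -> exists f g : V -> R,
    forall u v, u != v -> (e u v <-> f u <= g v /\ f v <= g u).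
Proof.
move=> [B [boxB eB]].
have /fin_all_exists[F FP] : forall v, exists ab : ('I_1 -> R) * ('I_1 -> R),
    (forall i, ab.1 i <= ab.2 i) /\
    B v = [set p | forall i, p ord0 i \in `[ab.1 i, ab.2 i]].
  by move=> v; have [a [b abB]] := boxB v; exists (a, b).
exists (fun v => (F v).1 ord0), (fun v => (F v).2 ord0) => u v uv.
have [[Fu Bu] [Fv Bv]] := (FP u, FP v); rewrite (eB u v uv) Bu Bv.
split=> [[p [/= /(_ ord0) + /(_ ord0)]]|[uv1 vu1]].
  by rewrite !in_itv /= => /andP[? ?] /andP[? ?]; split; apply: le_trans; eassumption.
exists (const_mx (Num.max ((F u).1 ord0) ((F v).1 ord0))).
split=> i /=; rewrite (ord1 i) mxE in_itv /= le_max lexx ?orbT ge_max;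
  by rewrite ?Fu ?Fv ?andbT.
Qed.

(* The cycle would be an induced cycle of an interval graph: root the tree at
   the leaf whose interval ends first; then both neighbours of that leaf on the
   cycle contain this end, so they are adjacent. *)
Lemma halin_box1 (R : realType) (V : finType) (e : rel V) :
  halin R e -> box_representable R e 1 -> isomorphic e (@complete_graph 4).
Proof.
move=> hal /box_representable1_interval[f [g eE]].
have [[esym eirr] _ _] := hal.
have [t [c [uc c3 rooted]]] := halin_rooted hal.
have [x0 x0c] : exists x0, x0 \in c.
  by case: c c3 {uc rooted} => // x0 c _; exists x0; exact: mem_head.
case: (@arg_minP _ _ _ x0 (mem c) g x0c) => r rc rmin.
have [s [par [d [H cs]]]] := rooted r rc.
have [y [z [[ys zs yz] [ery erz] tiny]]] := leaf_edge_sides H.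
apply: (tiny_isomorphic H eirr); apply/tiny/(eE y z yz).
have ry : r != y by rewrite eq_sym (leaf_neq_root H).
have rz : r != z by rewrite eq_sym (leaf_neq_root H).
have [_ fy] := (eE r y ry).1 ery; have [_ fz] := (eE r z rz).1 erz.
have sc x : x \in s -> x \in c by rewrite (perm_mem cs) inE orbC => ->.
have [gy gz] : g r <= g y /\ g r <= g z by split; apply/rmin/sc.
by split; apply: le_trans; eassumption.
Qed.

Lemma boxicity_eq (R : realType) (V : finType) (e : rel V) (k : nat) :
  is_boxicity R e k -> boxicity R e = k.
Proof.
move=> ek; rewrite /boxicity; apply: xget_unique => // j ej.
case: ek ej => k1 ek kmin [j1 ej jmin].
by apply/eqP; rewrite eqn_leq kmin // jmin.
Qed.

Theorem corollary1 (R : realType) (V : finType) (e : rel V) :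
  halin R e ->
  (~ isomorphic e (@complete_graph 4) -> boxicity R e = 2%N) /\
  (isomorphic e (@complete_graph 4) -> boxicity R e = 1%N).
Proof.
move=> hal; have [[esym eirr] plane _] := hal; split=> [nK4|[f bij_f fE]].
  apply: boxicity_eq; split=> // [|j j1 ej].
    have [t [c [uc c3 rooted]]] := halin_rooted hal.
    have [r rc] : exists r, r \in c.
      by case: c c3 {uc rooted} => // r c _; exists r; exact: mem_head.
    have [s [par [d [H _]]]] := rooted r rc; apply: (halin_box2 H plane).
    (* A cycle of length 3 would make the graph [K_4]. *)
    rewrite ltn_neqAle (rh_size H) andbT eq_sym.
    by apply/eqP => s2; apply: nK4; exact: tiny_isomorphic H eirr s2.
  rewrite ltn_neqAle j1 andbT; apply/eqP => j1'; rewrite -j1' in ej.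
  by apply: nK4; exact: halin_box1 hal ej.
(* All vertices of [K_4] receive the same degenerate box, the origin. *)
apply: boxicity_eq; split=> //; exists (fun=> [set p | forall i, p ord0 i \in `[0, 0]]).
split=> [v|u v uv]; first by exists (fun=> 0), (fun=> 0).
rewrite -fE /complete_graph (inj_eq (bij_inj bij_f)) uv; split=> // _.
by exists 0; split=> i /=; rewrite mxE in_itv /= lexx.
Qed.
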